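(* Let $V$ be a vertex operator algebra, let $\sigma_1,\sigma_2$ be commuting automorphisms of $V$ and $T$ a positive integer with $\sigma_1^T=\sigma_2^T=1$, let $\sigma=(\sigma_1\sigma_2)^{-1}$, and let $z$ be a nonzero complex number. Let $W$ be a weak $\sigma$-twisted $V$-module, $W_1$ a weak $\sigma_1$-twisted $V$-module, and $W_2$ a weak $\sigma_2$-twisted $V$-module. Then a linear map $F:W_1\otimes W_2\to W^*$ is a $P(z)$-intertwining map if and only if $F$ is a homomorphism of weak $\sigma_1\otimes\sigma_2$-twisted $V\otimes V$-modules from $W_1\otimes W_2$ into $\mathfrak D^{(z)}_{\sigma_1,\sigma_2}(W)$.
   Context: Formal calculus. Vector spaces are over $\mathbb C$; $\mathbb N=\{0,1,2,\dots\}$; $\delta(x)=\sum_{n\in\mathbb Z}x^n$; $U((x))$ is the space of Laurent series in integer powers of $x$ with finitely many negative powers. Complex powers of binomials are expanded in nonnegative integer powers of the second summand. For $\xi\in\mathbb C^\times$: $\log\xi=\ln|\xi|+i\arg\xi$ with $0\le\arg\xi<2\pi$, $\xi^\alpha=e^{\alpha\log\xi}$, $(x\pm\xi)^\alpha=\sum_{j\ge0}\binom{\alpha}{j}(\pm\xi)^jx^{\alpha-j}$, $(\xi\pm x)^\alpha=\sum_{j\ge0}\binom{\alpha}{j}\xi^{\alpha-j}(\pm x)^j$. An expression $y^{-1}\delta\left(\frac{a-b}{y}\right)\left(\frac{a-b}{y}\right)^\alpha$ means $\sum_{n\in\mathbb Z}y^{-n-1-\alpha}(a-b)^{n+\alpha}$.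 Twisted modules. $V$ is a vertex operator algebra with conformal vector $\omega$, $Y(\omega,x)=\sum_n L(n)x^{-n-2}$ ($\mathbb Z$-graded by $L(0)$ with finite-dimensional weight spaces, vanishing for sufficiently negative weights); automorphisms of $V$ fix $\omega$. For an automorphism $\tau$ with $\tau^T=1$ and $V^j=\{v:\tau v=e^{2\pi ij/T}v\}$, a weak $\tau$-twisted $V$-module is a vector space $M$ with a linear map $Y_M(\cdot,x):V\to(\mathrm{End}\,M)[[x^{1/T},x^{-1/T}]]$ such that $Y_M({\bf 1},x)=1$, $Y_M(v,x)w\in x^{-j/T}M((x))$ for $v\in V^j$, $w\in M$, and for $u\in V^j$, $v\in V$: $$x_0^{-1}\delta\left(\tfrac{x_1-x_2}{x_0}\right)Y_M(u,x_1)Y_M(v,x_2)-x_0^{-1}\delta\left(\tfrac{x_2-x_1}{-x_0}\right)Y_M(v,x_2)Y_M(u,x_1)=x_2^{-1}\delta\left(\tfrac{x_1-x_0}{x_2}\right)\left(\tfrac{x_1-x_0}{x_2}\right)^{-j/T}Y_M(Y(u,x_0)v,x_2).$$ $W_1\otimes W_2$ is a weak $\sigma_1\otimes\sigma_2$-twisted $V\otimes V$-module with $Y(u\otimes v,x)=Y_{W_1}(u,x)\otimes Y_{W_2}(v,x)$. The module $\mathfrak D$. For $j_1,j_2\in\mathbb Z$ put $V^{(j_1,j_2)}=\{v\in V:\sigma_r(v)=e^{2\pi ij_r/T}v,\ r=1,2\}$. For the weak $\sigma$-twisted module $(W,Y_W)$ set $Y_W^o(v,x)=Y_W(e^{xL(1)}(-x^{-2})^{L(0)}v,x^{-1})$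 and define $Y_W^*(v,x)$ on the full dual $W^*$ by $\langle Y_W^*(v,x)\alpha,w\rangle=\langle\alpha,Y_W^o(v,x)w\rangle$; put $Y_W^*(v,x+z)\alpha=e^{z\frac{d}{dx}}Y_W^*(v,x)\alpha$. $\mathfrak D^{(z)}_{\sigma_1,\sigma_2}(W)$ is the set of all $\alpha\in W^*$ such that for every $v\in V^{(j_1,j_2)}$, $j_1,j_2\in\mathbb Z$, there is $k\in\mathbb N$ with $x^{j_2/T}(x-z)^{k+j_1/T}Y_W^*(v,x)\alpha\in W^*((x))$. For such $\alpha,v,k$ put $$Y_\sigma^R(v,x)\alpha=e^{-(k+j_1/T)\pi i}(z-x)^{-k-j_1/T}\left[(x-z)^{k+j_1/T}Y_W^*(v,x)\alpha\right],$$ $$Y_\sigma^L(v,x)\alpha=(z+x)^{-l-j_2/T}\left[(x+z)^{l+j_2/T}Y_W^*(v,x+z)\alpha\right],$$ where $l\in\mathbb N$ is any integer with $x^{j_1/T}(x+z)^{l+j_2/T}Y_W^*(v,x+z)\alpha\in W^*((x))$ (such $l$ exists; the definitions are independent of $k,l$). It is known that $\mathfrak D^{(z)}_{\sigma_1,\sigma_2}(W)$ is a weak $\sigma_1\otimes\sigma_2$-twisted $V\otimes V$-module with $Y_\sigma^{\rm reg}(u\otimes v,x)=Y_\sigma^L(u,x)Y_\sigma^R(v,x)$. $P(z)$-intertwining maps. A $P(z)$-intertwining map of type $\binom{W^*}{W_1\,W_2}$ is a linear map $F:W_1\otimes W_2\to W^*$ such that for $v\in V^{(j_1,j_2)}$,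 $j_1,j_2\in\mathbb Z$, $w_{(1)}\in W_1$, $w_{(2)}\in W_2$: $$x_0^{-1}\delta\left(\tfrac{x_1-z}{x_0}\right)\left(\tfrac{x_1-z}{x_0}\right)^{j_1/T}Y_W^*(v,x_1)F(w_{(1)}\otimes w_{(2)})-e^{\frac{j_1}{T}\pi i}x_0^{-1}\delta\left(\tfrac{z-x_1}{-x_0}\right)\left(\tfrac{z-x_1}{x_0}\right)^{j_1/T}F(w_{(1)}\otimes Y(v,x_1)w_{(2)})$$ $$=z^{-1}\delta\left(\tfrac{x_1-x_0}{z}\right)\left(\tfrac{x_1-x_0}{z}\right)^{-j_2/T}F(Y(v,x_0)w_{(1)}\otimes w_{(2)}).$$ *)

(* Defs.v *)
(* MathComp with MathComp-Analysis; the complex numbers are R[i] for R : realType. *)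
From HB Require Import structures.
From mathcomp Require Import all_boot all_order all_algebra generic_quotient.
From mathcomp Require Import all_classical all_reals sequences exp trigo.
From mathcomp Require Import complex.

Set Implicit Arguments.
Unset Strict Implicit.
Unset Printing Implicit Defensive.

Import Order.TTheory GRing.Theory Num.Theory.

Local Open Scope ring_scope.
Local Open Scope quotient_scope.
Local Open Scope classical_set_scope.
Local Open Scope complex_scope.

(** * Tensor products: formal sums of pairs, stored as lists, modulo the
    bilinearity relations *)

Section Tensor.
Variables (K : fieldType) (U W : lmodType K).

Inductive tens_rel : seq (U * W) -> seq (U * W) -> Prop :=
| tens_refl s : tens_rel s s
| tens_sym s t : tens_rel s t -> tens_rel t s
| tens_trans s t r : tens_rel s t -> tens_rel t r -> tens_rel s r
| tens_cat s s' t t' :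
    tens_rel s s' -> tens_rel t t' -> tens_rel (s ++ t) (s' ++ t')
| tens_catC s t : tens_rel (s ++ t) (t ++ s)
| tens_zero w : tens_rel [:: (0, w)] [::]
| tens_addl u u' w : tens_rel [:: (u + u', w)] [:: (u, w); (u', w)]
| tens_addr u w w' : tens_rel [:: (u, w + w')] [:: (u, w); (u, w')]
| tens_scale a u w : tens_rel [:: (a *: u, w)] [:: (u, a *: w)].

Definition tens_eqb (s t : seq (U * W)) : bool := `[< tens_rel s t >].

Lemma tens_eqb_refl : reflexive tens_eqb.
Proof. by move=> s; apply/asboolP; exact: tens_refl. Qed.

Lemma tens_eqb_sym : symmetric tens_eqb.
Proof. by move=> s t; apply/asboolP/asboolP; exact: tens_sym. Qed.

Lemma tens_eqb_trans : transitive tens_eqb.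
Proof.
by move=> t s r /asboolP h1 /asboolP h2; apply/asboolP; exact: tens_trans h2.
Qed.

Canonical tens_equiv : equiv_rel (seq (U * W)) :=
  EquivRel tens_eqb tens_eqb_refl tens_eqb_sym tens_eqb_trans.

Definition tensor := {eq_quot tens_equiv}.

HB.instance Definition _ := Choice.on tensor.
HB.instance Definition _ := EqQuotient.on tensor.

Definition tclass (s : seq (U * W)) : tensor := \pi s.

Definition tpure (u : U) (w : W) : tensor := tclass [:: (u, w)].

Lemma tclassP s t : tclass s = tclass t <-> tens_rel s t.
Proof.
by split=> [/eqquotP /asboolP //|h]; apply/eqquotP/asboolP.
Qed.

Lemma tens_rel_repr s : tens_rel (repr (tclass s)) s.
Proof. by apply/tclassP; rewrite /tclass reprK. Qed.

Definition tens_map (a : K) (s : seq (U * W)) : seq (U * W) :=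
  [seq (a *: p.1, p.2) | p <- s].

Lemma tens_map_rel a s t :
  tens_rel s t -> tens_rel (tens_map a s) (tens_map a t).
Proof.
rewrite /tens_map; elim=> {s t} /=.
- by move=> s; exact: tens_refl.
- by move=> s t _; exact: tens_sym.
- by move=> s t r _ h1 _ h2; exact: tens_trans h1 h2.
- by move=> s s' t t' _ h1 _ h2; rewrite !map_cat; exact: tens_cat.
- by move=> s t; rewrite !map_cat; exact: tens_catC.
- by move=> w; rewrite scaler0; exact: tens_zero.
- by move=> u u' w; rewrite scalerDr; exact: tens_addl.
- by move=> u w w'; exact: tens_addr.
- by move=> b u w; rewrite scalerA mulrC -scalerA; exact: tens_scale.
Qed.

Definition tens_add (x y : tensor) : tensor := tclass (repr x ++ repr y).
Definition tens_scaling (a : K) (x : tensor) : tensor :=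
  tclass (tens_map a (repr x)).

Lemma tens_addE s t : tens_add (tclass s) (tclass t) = tclass (s ++ t).
Proof. by apply/tclassP; apply: tens_cat; exact: tens_rel_repr. Qed.

Lemma tens_scalingE a s : tens_scaling a (tclass s) = tclass (tens_map a s).
Proof. by apply/tclassP; apply: tens_map_rel; exact: tens_rel_repr. Qed.

Lemma tclass_ind (P : tensor -> Prop) : (forall s, P (tclass s)) -> forall x, P x.
Proof. by move=> h x; rewrite -[x]reprK; exact: h. Qed.

Lemma tens_addA : associative tens_add.
Proof.
elim/tclass_ind=> s; elim/tclass_ind=> t; elim/tclass_ind=> r.
by rewrite !tens_addE catA.
Qed.

Lemma tens_addC : commutative tens_add.
Proof.
elim/tclass_ind=> s; elim/tclass_ind=> t; rewrite !tens_addE.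
by apply/tclassP; exact: tens_catC.
Qed.

Lemma tens_add0 : left_id (tclass [::]) tens_add.
Proof. by elim/tclass_ind=> s; rewrite tens_addE. Qed.

Lemma tens_map_cat_rel a b s :
  tens_rel (tens_map (a + b) s) (tens_map a s ++ tens_map b s).
Proof.
elim: s => [|[u w] s ih] /=; first exact: tens_refl.
rewrite -cat1s -[(b *: u, w) :: _]cat1s -cat_cons -[(a *: u, w) :: _]cat1s.
rewrite catA.
apply: (@tens_trans _ (([:: (a *: u, w)] ++ [:: (b *: u, w)]) ++
                       (tens_map a s ++ tens_map b s))).
  by apply: tens_cat ih; rewrite scalerDl; exact: tens_addl.
rewrite -!catA; apply: tens_cat; first exact: tens_refl.
rewrite !catA; apply: tens_cat; last exact: tens_refl.
exact: tens_catC.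
Qed.

Lemma tens_map0_rel s : tens_rel (tens_map 0 s) [::].
Proof.
elim: s => [|[u w] s ih] /=; first exact: tens_refl.
rewrite -cat1s -[[::]]/([::] ++ [::]); apply: tens_cat ih.
by rewrite scale0r; exact: tens_zero.
Qed.

Lemma tens_map1 s : tens_map 1 s = s.
Proof. by rewrite /tens_map -[RHS]map_id; apply: eq_map => -[u w]; rewrite scale1r. Qed.

Lemma tens_addN : left_inverse (tclass [::]) (tens_scaling (-1)) tens_add.
Proof.
elim/tclass_ind=> s; rewrite tens_scalingE tens_addE; apply/tclassP.
rewrite -{2}[s]tens_map1.
apply: tens_trans (tens_sym (tens_map_cat_rel (-1) 1 s)) _.
by rewrite addNr; exact: tens_map0_rel.
Qed.

HB.instance Definition _ :=
  GRing.isZmodule.Build tensor tens_addA tens_addC tens_add0 tens_addN.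

Lemma tens_scaleA a b x : tens_scaling a (tens_scaling b x) = tens_scaling (a * b) x.
Proof.
elim/tclass_ind: x => s; rewrite !tens_scalingE /tens_map -map_comp.
by congr tclass; apply: eq_map => p /=; rewrite scalerA.
Qed.

Lemma tens_scale1 : left_id 1 tens_scaling.
Proof. by elim/tclass_ind=> s; rewrite tens_scalingE tens_map1. Qed.

Lemma tens_scaleDr : right_distributive tens_scaling +%R.
Proof.
move=> a; elim/tclass_ind=> s; elim/tclass_ind=> t.
rewrite -[_ + _]/(tens_add _ _) -[RHS]/(tens_add _ _).
by rewrite !(tens_scalingE, tens_addE) /tens_map map_cat.
Qed.

Lemma tens_scaleDl x : {morph tens_scaling^~ x : a b / a + b}.
Proof.
elim/tclass_ind: x => s a b; rewrite -[RHS]/(tens_add _ _).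
rewrite !(tens_scalingE, tens_addE); apply/tclassP.
exact: tens_map_cat_rel.
Qed.

HB.instance Definition _ := GRing.Zmodule_isLmodule.Build K tensor
  tens_scaleA tens_scale1 tens_scaleDr tens_scaleDl.

Lemma tclass_sum s : tclass s = \sum_(p <- s) tpure p.1 p.2.
Proof.
elim: s => [|[u w] s ih]; first by rewrite big_nil.
by rewrite big_cons -ih /= -[RHS]/(tens_add _ _) tens_addE.
Qed.

Lemma tensor_sum (x : tensor) : x = \sum_(p <- repr x) tpure p.1 p.2.
Proof. by rewrite -tclass_sum /tclass reprK. Qed.

(* The linear map on the tensor product induced by f; it is only meaningful
   when f is bilinear, see tliftE and tlift_linear. *)
Definition tlift (X : lmodType K) (f : U -> W -> X) (x : tensor) : X :=
  \sum_(p <- repr x) f p.1 p.2.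

Definition bilinear_map (X : lmodType K) (f : U -> W -> X) : Prop :=
  (forall w, linear (f^~ w)) /\ (forall u, linear (f u)).

Lemma bilinear_map_add (X : lmodType K) (f : U -> W -> X) : bilinear_map f ->
  (forall u u' w, f (u + u') w = f u w + f u' w) /\
  (forall u w w', f u (w + w') = f u w + f u w').
Proof.
move=> [hl hr]; split=> [u u' w|u w w'].
  by have := hl w 1 u u'; rewrite !scale1r.
by have := hr u 1 w w'; rewrite !scale1r.
Qed.

Lemma bilinear_map_scale (X : lmodType K) (f : U -> W -> X) : bilinear_map f ->
  [/\ forall w, f 0 w = 0, forall u, f u 0 = 0,
      forall a u w, f (a *: u) w = a *: f u w &
      forall a u w, f u (a *: w) = a *: f u w].
Proof.
move=> hf; have [hDl hDr] := bilinear_map_add hf; case: hf => hl hr.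
have f0l w : f 0 w = 0.
  by apply: (addrI (f 0 w)); rewrite -hDl !addr0.
have f0r u : f u 0 = 0.
  by apply: (addrI (f u 0)); rewrite -hDr !addr0.
split=> // a u w.
  by have := hl w a u 0; rewrite !addr0 f0l addr0.
by have := hr u a w 0; rewrite !addr0 f0r addr0.
Qed.

Lemma tlift_rel (X : lmodType K) (f : U -> W -> X) s t : bilinear_map f ->
  tens_rel s t -> \sum_(p <- s) f p.1 p.2 = \sum_(p <- t) f p.1 p.2.
Proof.
move=> hf; have [hDl hDr] := bilinear_map_add hf.
have [h0 _ hZl hZr] := bilinear_map_scale hf.
elim=> {s t} /=.
- by [].
- by move=> s t _ ->.
- by move=> s t r _ -> _ ->.
- by move=> s s' t t' _ h1 _ h2; rewrite !big_cat /= h1 h2.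
- by move=> s t; rewrite !big_cat /= addrC.
- by move=> w; rewrite big_seq1 big_nil /= h0.
- by move=> u u' w; rewrite !big_cons !big_nil !addr0 /= hDl.
- by move=> u w w'; rewrite !big_cons !big_nil !addr0 /= hDr.
- by move=> a u w; rewrite !big_seq1 /= hZl hZr.
Qed.

Lemma tlift_class (X : lmodType K) (f : U -> W -> X) s : bilinear_map f ->
  tlift f (tclass s) = \sum_(p <- s) f p.1 p.2.
Proof. by move=> hf; apply: tlift_rel hf _; exact: tens_rel_repr. Qed.

Lemma tliftE (X : lmodType K) (f : U -> W -> X) u w : bilinear_map f ->
  tlift f (tpure u w) = f u w.
Proof. by move=> hf; rewrite tlift_class// big_seq1. Qed.

Lemma tlift_linear (X : lmodType K) (f : U -> W -> X) : bilinear_map f ->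
  linear (tlift f).
Proof.
move=> hf a; elim/tclass_ind=> s; elim/tclass_ind=> t.
have [_ _ hZl _] := bilinear_map_scale hf.
rewrite -[_ *: _]/(tens_scaling _ _) -[tens_scaling _ _ + _]/(tens_add _ _).
rewrite tens_scalingE tens_addE !tlift_class// big_cat /= big_map scaler_sumr.
by congr (_ + _); apply: eq_bigr => p _ /=; rewrite hZl.
Qed.

Lemma tpure_bilinear : bilinear_map tpure.
Proof.
split=> [w a u u'|u a w w'].
- rewrite -[_ *: tpure _ _]/(tens_scaling _ _) -[RHS]/(tens_add _ _).
  rewrite tens_scalingE tens_addE; apply/tclassP; exact: tens_addl.
- rewrite -[_ *: tpure _ _]/(tens_scaling _ _) -[RHS]/(tens_add _ _).
  rewrite tens_scalingE tens_addE; apply/tclassP.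
  apply: tens_trans (tens_addr _ _ _) _; rewrite -cat1s.
  apply: (@tens_cat [:: (u, a *: w)] _ [:: (u, w')] _); last exact: tens_refl.
  by apply: tens_sym; exact: tens_scale.
Qed.

End Tensor.

(** * The full dual *)

Section Dual.
Variables (K : fieldType) (W : lmodType K).

Definition functional : {pred (W -> K^o)} := fun f => `[< linear f >].

Lemma functional_submod : submod_closed functional.
Proof.
split=> [|a f g /asboolP hf /asboolP hg]; apply/asboolP => b u v.
  by rewrite scaler0 addr0.
rewrite !fctE hf hg !scalerDr !scalerA [b * a]mulrC -!addrA.
by congr (_ + _); rewrite addrCA.
Qed.

HB.instance Definition _ :=
  GRing.isSubmodClosed.Build K (W -> K^o) functional functional_submod.

Record dual := Dual { dual_fun :> W -> K^o; _ : dual_fun \in functional }.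

HB.instance Definition _ := [isSub for dual_fun].
HB.instance Definition _ := [Choice of dual by <:].
HB.instance Definition _ := [SubChoice_isSubLmodule of dual by <:].

End Dual.

(** * Complex powers *)

Section ComplexPowers.
Variable R : realType.

Definition cexp (w : R[i]) : R[i] :=
  (expR (complex.Re w) * cos (complex.Im w)) +i*
  (expR (complex.Re w) * sin (complex.Im w)).

Definition cmod (xi : R[i]) : R :=
  Num.sqrt (complex.Re xi ^+ 2 + complex.Im xi ^+ 2).

(* The argument in [0, 2 pi[ of a nonzero number. *)
Definition carg (xi : R[i]) : R :=
  if 0 <= complex.Im xi then acos (complex.Re xi / cmod xi)
  else pi *+ 2 - acos (complex.Re xi / cmod xi).

Definition clog (xi : R[i]) : R[i] := ln (cmod xi) +i* carg xi.

Definition cpow (xi : R[i]) (alpha : rat) : R[i] :=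
  cexp (ratr alpha * clog xi).

(* e ^ (q pi i) *)
Definition epi (q : rat) : R[i] := cexp (0 +i* (ratr q * pi)).

(** * Formal series

    A formal series in rational powers of x with coefficients in U is a
    function f : rat -> U, where f p is the coefficient of x^p; similarly for
    several variables.  The sums \sum_(i \in A) below are sums of finitely
    supported families. *)

Definition mono (a p : rat) : R[i] := (p == a)%:R.

Definition gbinom (alpha : rat) (i : nat) : R[i] :=
  ratr ((\prod_(m < i) (alpha - m%:R)) / i`!%:R).

(* coefficient of a^p b^q in (a + s b)^beta *)
Definition pow_xx (beta : rat) (s : R[i]) (p q : rat) : R[i] :=
  \sum_(i \in [set: nat])
    gbinom beta i * s ^+ i * mono (beta - i%:R) p * mono i%:R q.

(* coefficient of x^p in (x + c)^beta *)
Definition pow_xc (beta : rat) (c : R[i]) (p : rat) : R[i] :=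
  \sum_(i \in [set: nat]) gbinom beta i * c ^+ i * mono (beta - i%:R) p.

(* coefficient of x^p in (xi + s x)^beta *)
Definition pow_cx (xi : R[i]) (beta : rat) (s : R[i]) (p : rat) : R[i] :=
  \sum_(i \in [set: nat])
    gbinom beta i * cpow xi (beta - i%:R) * s ^+ i * mono i%:R p.

(* coefficient of y^r a^p b^q in y^-1 delta((a-b)/y) ((a-b)/y)^alpha *)
Definition delta_xx (alpha r p q : rat) : R[i] :=
  \sum_(n \in [set: int])
    mono (- n%:~R - 1 - alpha) r * pow_xx (n%:~R + alpha) (-1) p q.

(* coefficient of y^r a^p b^q in y^-1 delta((a-b)/-y) *)
Definition delta_xxN (r p q : rat) : R[i] :=
  \sum_(n \in [set: int])
    (-1) ^ n * mono (- n%:~R - 1) r * pow_xx n%:~R (-1) p q.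

(* coefficient of y^r x^p in y^-1 delta((x-z)/y) ((x-z)/y)^alpha *)
Definition delta_xz (z : R[i]) (alpha r p : rat) : R[i] :=
  \sum_(n \in [set: int])
    mono (- n%:~R - 1 - alpha) r * pow_xc (n%:~R + alpha) (- z) p.

(* coefficient of y^r x^p in y^-1 delta((z-x)/-y) ((z-x)/y)^alpha *)
Definition delta_zxN (z : R[i]) (alpha r p : rat) : R[i] :=
  \sum_(n \in [set: int])
    (-1) ^ n * mono (- n%:~R - 1 - alpha) r * pow_cx z (n%:~R + alpha) (-1) p.

(* coefficient of a^p b^q in z^-1 delta((a-b)/z) ((a-b)/z)^alpha *)
Definition delta_xx_at (z : R[i]) (alpha p q : rat) : R[i] :=
  \sum_(n \in [set: int])
    cpow z (- n%:~R - 1 - alpha) * pow_xx (n%:~R + alpha) (-1) p q.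

(* x^s f(x) *)
Definition xshift (U : Type) (s : rat) (f : rat -> U) : rat -> U :=
  fun p => f (p - s).

(* f(x) \in U((x)) *)
Definition laurent (U : zmodType) (f : rat -> U) : Prop :=
  (forall p, p \isn't a Num.int -> f p = 0) /\
  exists N : int, forall p, p < N%:~R -> f p = 0.

Definition deriv_series (U : lmodType R[i]) (f : rat -> U) : rat -> U :=
  fun p => (ratr (p + 1) : R[i]) *: f (p + 1).

(* Series whose coefficients are functionals on W are multiplied and shifted
   after evaluation at each w : W, where all the sums become finite. *)
Definition conv (W : lmodType R[i]) (c : rat -> R[i])
    (f : rat -> W -> R[i]^o) : rat -> W -> R[i]^o :=
  fun p w => \sum_(q \in [set: rat]) c q * f (p - q) w.

(* f(x + z) = e^(z d/dx) f(x) *)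
Definition translate (W : lmodType R[i]) (z : R[i])
    (f : rat -> W -> R[i]^o) : rat -> W -> R[i]^o :=
  fun p w => \sum_(i \in [set: nat])
    z ^+ i / i`!%:R * iter i (@deriv_series (W -> R[i]^o)) f p w.

(** * Vertex operator algebras and twisted modules

    Y v p w is the coefficient of x^p in Y(v,x)w. *)

Definition jacobi (A M : lmodType R[i]) (YA : A -> rat -> A -> A)
    (YM : A -> rat -> M -> M) (alpha : rat) (u v : A) (w : M) : Prop :=
  forall p0 p1 p2 : rat,
    \sum_(e \in [set: rat * rat])
        delta_xx 0 p0 e.1 e.2 *: YM u (p1 - e.1) (YM v (p2 - e.2) w)
    - \sum_(e \in [set: rat * rat])
        delta_xxN p0 e.1 e.2 *: YM v (p2 - e.1) (YM u (p1 - e.2) w)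
    = \sum_(e \in [set: rat * rat])
        delta_xx alpha e.1 p1 e.2 *: YM (YA u (p0 - e.2) v) (p2 - e.1) w.

(* L(n), where Y(omega,x) = \sum_n L(n) x^(-n-2) *)
Definition virasoro_op (A M : Type) (Y : A -> rat -> M -> M) (omega : A)
  (n : int) : M -> M := Y omega (- n%:~R - 2).

Record voa : Type := VOA {
  voa_sort :> lmodType R[i];
  vac : voa_sort;
  conf : voa_sort;
  charge : R[i];
  Yvoa : voa_sort -> rat -> voa_sort -> voa_sort;
  voaL := virasoro_op Yvoa conf;
  Yvoa_linear_l : forall p w, linear (fun v => Yvoa v p w);
  Yvoa_linear_r : forall v p, linear (Yvoa v p);
  Yvoa_laurent : forall v w, laurent (fun p => Yvoa v p w);
  Yvoa_vac : forall p v, Yvoa vac p v = if p == 0 then v else 0;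
  Yvoa_creation : forall v p, p <= 0 ->
    Yvoa v p vac = if p == 0 then v else 0;
  Yvoa_jacobi : forall u v w, jacobi Yvoa Yvoa 0 u v w;
  voa_virasoro : forall (m n : int) v,
    voaL m (voaL n v) - voaL n (voaL m v) =
    (m - n)%:~R *: voaL (m + n) v +
    (if m + n == 0 then (m ^+ 3 - m)%:~R / 12 * charge else 0) *: v;
  voa_derivative : forall v p w,
    Yvoa (voaL (-1) v) p w = deriv_series (fun q => Yvoa v q w) p;
  voa_graded : forall v, exists c : int -> voa_sort,
    [/\ forall n, voaL 0 (c n) = n%:~R *: c n,
        finite_set [set n | c n != 0] &
        v = \sum_(n \in [set: int]) c n];
  voa_findim : forall n : int, exists s : seq voa_sort,
    forall v, voaL 0 v = n%:~R *: v ->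
    exists a : nat -> R[i], v = \sum_(i < size s) a i *: s`_i;
  voa_truncated : exists N : int, forall n : int, n < N ->
    forall v, voaL 0 v = n%:~R *: v -> v = 0 }.

(* the weight components of v *)
Definition wt_comp (V : voa) (v : V) : int -> V :=
  projT1 (cid (voa_graded v)).

Record voa_aut (V : voa) (s : V -> V) : Prop := VoaAut {
  aut_linear : linear s;
  aut_bij : bijective s;
  aut_vac : s (vac V) = vac V;
  aut_conf : s (conf V) = conf V;
  aut_Y : forall u p v, s (Yvoa u p v) = Yvoa (s u) p (s v) }.

(* j / T *)
Definition qfrac (T : nat) (j : int) : rat := j%:~R / T%:R.

(* s v = e^(2 pi i j / T) v *)
Definition eigen (V : voa) (T : nat) (s : V -> V) (j : int) (v : V) : Prop :=
  s v = epi (2 * qfrac T j) *: v.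

Record twisted_module (V : voa) (T : nat) (s : V -> V) : Type := TwistedModule {
  tm_sort :> lmodType R[i];
  Ytm : V -> rat -> tm_sort -> tm_sort;
  Ytm_linear_l : forall p w, linear (fun v => Ytm v p w);
  Ytm_linear_r : forall v p, linear (Ytm v p);
  Ytm_support : forall v p w, p * T%:R \isn't a Num.int -> Ytm v p w = 0;
  Ytm_vac : forall p w, Ytm (vac V) p w = if p == 0 then w else 0;
  Ytm_laurent : forall j v w, eigen T s j v ->
    laurent (xshift (qfrac T j) (fun p => Ytm v p w));
  Ytm_jacobi : forall j u v w, eigen T s j u ->
    jacobi (@Yvoa V) Ytm (- qfrac T j) u v w }.

(** * The action of V (x) V on a tensor product of modules *)

Definition Ytensor (V : voa) (T : nat) (s1 s2 : V -> V)
    (W1 : twisted_module T s1) (W2 : twisted_module T s2)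
    (a : tensor V V) (p : rat) (t : tensor W1 W2) : tensor W1 W2 :=
  tlift (fun u v : V =>
    tlift (fun (w1 : W1) (w2 : W2) =>
      \sum_(q \in [set: rat]) tpure (Ytm u q w1) (Ytm v (p - q) w2)) t) a.

(** * The module D of W and its vertex operators

    Vectors of the dual of W are handled here as functions on W. *)

Section Regular.
Variables (V : voa) (T : nat) (s1 s2 s : V -> V) (z : R[i]).
Variable W : twisted_module T s.

Definition eigen2 (j1 j2 : int) (v : V) : Prop :=
  eigen T s1 j1 v /\ eigen T s2 j2 v.

(* On a vector of weight n, e^(x L(1)) (-x^-2)^L(0) acts as
   \sum_m (-1)^n x^(m - 2 n) L(1)^m / m!. *)
Definition Yopp (v : V) (p : rat) (w : W) : W :=
  \sum_(e \in [set: int * nat])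
    ((-1) ^ e.1 / e.2`!%:R : R[i]) *:
    Ytm (iter e.2 (voaL 1) (wt_comp v e.1)) (e.2%:R - 2 * e.1%:~R - p) w.

Definition Ystar (v : V) (al : W -> R[i]^o) : rat -> W -> R[i]^o :=
  fun p w => al (Yopp v p w).

(* (x - z)^(k + j1/T) Y*(v,x) alpha *)
Definition clearedR (j1 : int) (k : nat) (v : V) (al : W -> R[i]^o) :=
  conv (pow_xc (k%:R + qfrac T j1) (- z)) (Ystar v al).

(* (x + z)^(l + j2/T) Y*(v,x+z) alpha *)
Definition clearedL (j2 : int) (l : nat) (v : V) (al : W -> R[i]^o) :=
  conv (pow_xc (l%:R + qfrac T j2) z) (translate z (Ystar v al)).

Definition goodR (j1 j2 : int) (v : V) (al : W -> R[i]^o) : set nat :=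
  [set k | laurent (xshift (qfrac T j2) (clearedR j1 k v al))].

Definition goodL (j1 j2 : int) (v : V) (al : W -> R[i]^o) : set nat :=
  [set l | laurent (xshift (qfrac T j1) (clearedL j2 l v al))].

Definition Dreg : set (W -> R[i]^o) :=
  [set al | linear al /\
    forall j1 j2 v, eigen2 j1 j2 v -> exists k, goodR j1 j2 v al k].

(* In YR and YL the exponents k and l are arbitrary admissible ones. *)
Definition YR (j1 j2 : int) (v : V) (p : rat) (al : W -> R[i]^o) : W -> R[i]^o :=
  let k := xget 0%N (goodR j1 j2 v al) in
  let beta := k%:R + qfrac T j1 in
  epi (- beta) *: conv (pow_cx z (- beta) (-1)) (clearedR j1 k v al) p.

Definition YL (j1 j2 : int) (v : V) (p : rat) (al : W -> R[i]^o) : W -> R[i]^o :=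
  let l := xget 0%N (goodL j1 j2 v al) in
  let beta := l%:R + qfrac T j2 in
  conv (pow_cx z (- beta) 1) (clearedL j2 l v al) p.

(* Coefficient of x^p in Y^L(u,x) Y^R(v,x) alpha, for u in V^(i1,i2) and v in
   V^(j1,j2). *)
Definition YLR (i1 i2 : int) (u : V) (j1 j2 : int) (v : V) (p : rat)
    (al : W -> R[i]^o) : W -> R[i]^o :=
  \sum_(q \in [set: rat]) YL i1 i2 u (p - q) (YR j1 j2 v q al).

(* Yreg p al a be: the coefficient of x^p in Y^reg(a,x) alpha is be.  This is
   the graph of the linear extension to V (x) V of
   u (x) v |-> Y^L(u,x) Y^R(v,x) alpha, u and v joint eigenvectors (these span,
   as s1, s2 commute and have order dividing T).  It is single-valued for alpha
   in D because D is a V (x) V-module under Y^reg. *)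
Inductive Yreg (p : rat) (al : W -> R[i]^o) :
  tensor V V -> (W -> R[i]^o) -> Prop :=
| Yreg_zero : Yreg p al 0 0
| Yreg_add i1 i2 u j1 j2 v a be :
    eigen2 i1 i2 u -> eigen2 j1 j2 v -> Yreg p al a be ->
    Yreg p al (tpure u v + a) (YLR i1 i2 u j1 j2 v p al + be).

Variables (W1 : twisted_module T s1) (W2 : twisted_module T s2).

Definition P_intertwining (F : {linear tensor W1 W2 -> dual W}) : Prop :=
  forall j1 j2 v, eigen2 j1 j2 v ->
  forall (w1 : W1) (w2 : W2) (w : W) (p0 p1 : rat),
    conv (delta_xz z (qfrac T j1) p0) (Ystar v (F (tpure w1 w2))) p1 w
    - epi (qfrac T j1) *
      \sum_(q \in [set: rat])
        delta_zxN z (qfrac T j1) p0 q * F (tpure w1 (Ytm v (p1 - q) w2)) w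
    = \sum_(q \in [set: rat])
        delta_xx_at z (- qfrac T j2) p1 q * F (tpure (Ytm v (p0 - q) w1) w2) w.

(* F is a homomorphism of V (x) V-modules from W1 (x) W2 into D *)
Definition hom_into_Dreg (F : {linear tensor W1 W2 -> dual W}) : Prop :=
  (forall t, Dreg (F t)) /\
  (forall a p t be, Yreg p (F t) a be -> be = F (Ytensor a p t)).

End Regular.

End ComplexPowers.

(* Main.v *)
(** Fix w and put f(x) = <Y*(v,x) F(w1,w2), w>, g(x) = <F(w1, Y(v,x) w2), w> and
    h(x) = <F(Y(v,x) w1, w2), w>.  The coefficient of x_0^(-1-a) in the P(z)-identity is
      (x - z)^a f(x) - e^(a pi i) (z - x)^a g(x) = C_a(x),
    where C_a is linear in h, and multiplication by x - z turns each of the three terms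
    into the one of index a + 1.

    Since C_a = 0 for large a, the identity gives the relation defining Y^R; the
    coefficient of x^(-1-l-j2/T), to which g does not contribute for large l, gives the
    relation defining Y^L.  The choice of k and l is irrelevant because x - z and x + z
    are injective on series bounded below.

    Conversely, let D_a be the difference of the two sides.  The Y^R-relation says that
    D_a = 0 for large a, the Y^L-relation that one coefficient of D_a vanishes for every
    a.  As D_(a+1) = (x - z) D_a, and a doubly infinite series killed by x - z is
    determined by any one of its coefficients, downward induction gives D_a = 0. *)

(* D_a is infinite in both directions, so its vanishing for large a does not descend to small a:
   delta(x/z) is killed by x - z. Products with such series cannot be reassociated either, so the
   argument is run on numbers E(b, r), b an exponent and r a position, subject to E(b+1, r) = E(b,
   r-1) + c E(b, r), which is multiplication by x + c in coordinates. The Y^L-relation concerns (x +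
   z)^b f(x + z), while the P(z)-identity contains powers of x - z only. They meet through the
   substitution x -> x - z under the residue: the coefficient of x^r in (x + z)^b f(x + z) is that
   of x^(-1-b) in (x - z)^(-1-r) f(x). Thus the Y^L-relation at the single exponent b = l + j2/T,
   read over all r, gives the coefficient at x^(-1-b) of every D_a, a = -1-r; this is where the one
   known coefficient comes from. The homomorphism condition speaks only of composites Y^L(u,x)
   Y^R(v,x); taking u or v to be the vacuum separates the factors. *)
Require Import Defs.
From HB Require Import structures.
From mathcomp Require Import all_boot all_order all_algebra finmap ring.
From mathcomp Require Import all_classical all_reals sequences exp trigo complex.

Set Implicit Arguments.
Unset Strict Implicit.
Unset Printing Implicit Defensive.

Import Order.TTheory GRing.Theory Num.Theory.

Local Open Scope ring_scope.
Local Open Scope classical_set_scope.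
Local Open Scope complex_scope.

(** * Finitely supported sums *)

Section FiniteSums.
Variable M : zmodType.
Implicit Types F : nat -> M.

(** Moves a sum over all rational exponents to the progression that carries its support. *)
Lemma fsum_reindex (I J : choiceType) (h : I -> J) (G : J -> M) :
  injective h -> (forall j, (forall i, h i <> j) -> G j = 0) ->
  \sum_(j \in [set: J]) G j = \sum_(i \in [set: I]) G (h i).
Proof.
move=> hI G0; rewrite -(@fsbig_image _ _ _ _ _ _ h G); last by move=> x y _ _ /hI.
apply/esym/fsbig_widen => // j [_ /= hj]; apply: G0 => i hij.
by apply: hj; exists i.
Qed.

Lemma fsum_only (I : choiceType) (i : I) (F : I -> M) :
  (forall j, j <> i -> F j = 0) -> \sum_(j \in [set: I]) F j = F i.
Proof.
move=> F0; rewrite -(@fsbig_set1 M 0 +%R I i F); apply/esym/fsbig_widen => // j [_ /= ji].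
exact: F0.
Qed.

Lemma fsum_seq (I : choiceType) (r : seq I) (F : I -> M) : uniq r ->
  (forall j, j \notin r -> F j = 0) ->
  \sum_(j \in [set: I]) F j = \sum_(j <- r) F j.
Proof.
move=> ur F0; apply: esym; rewrite fsbig_seq//; apply: fsbig_widen => // j [_ /= jr].
by apply: F0; apply/negP.
Qed.

Lemma fsum_ord N F : (forall i, (N <= i)%N -> F i = 0) ->
  \sum_(i \in [set: nat]) F i = \sum_(i < N) F i.
Proof.
move=> F0; rewrite (@fsum_seq _ (iota 0 N)) ?iota_uniq//.
  by rewrite -(big_mkord xpredT) /index_iota subn0.
by move=> j; rewrite mem_iota add0n /= -leqNgt => /F0.
Qed.

Lemma fsum_recl F : (exists N, forall i, (N <= i)%N -> F i = 0) ->
  \sum_(i \in [set: nat]) F i = F 0%N + \sum_(i \in [set: nat]) F i.+1.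
Proof.
move=> [N F0]; rewrite (@fsum_ord N.+1) => [|i /ltnW]; last exact: F0.
by rewrite (@fsum_ord N) ?big_ord_recl// => i Ni; apply: F0; exact: leqW.
Qed.

Lemma fsum_split F G : (exists N, forall i, (N <= i)%N -> F i = 0) ->
  (exists N, forall i, (N <= i)%N -> G i = 0) ->
  \sum_(i \in [set: nat]) (F i + G i) =
  \sum_(i \in [set: nat]) F i + \sum_(i \in [set: nat]) G i.
Proof.
move=> [N F0] [N' G0]; pose m := maxn N N'.
have F1 i : (m <= i)%N -> F i = 0 by rewrite geq_max => /andP[/F0].
have G1 i : (m <= i)%N -> G i = 0 by rewrite geq_max => /andP[_ /G0].
rewrite (fsum_ord F1) (fsum_ord G1) (@fsum_ord m) ?big_split// => i mi.
by rewrite F1// G1// addr0.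
Qed.

(** Grouping by total degree. All sums run below N, where the order of summation is free; for each i
    the shift s = i + j maps 0 <= j < N - i onto i <= s < N. *)
Lemma fsum_antidiagonal (t : nat -> nat -> M) N :
  (forall i j, (N <= i + j)%N -> t i j = 0) ->
  \sum_(i \in [set: nat]) \sum_(j \in [set: nat]) t i j =
  \sum_(s \in [set: nat]) \sum_(i < s.+1) t i (s - i)%N.
Proof.
move=> t0; have h1 i : \sum_(j \in [set: nat]) t i j = \sum_(0 <= j < N) t i j.
  by rewrite (@fsum_ord N) ?big_mkord// => j Nj; apply/t0/(leq_trans Nj)/leq_addl.
rewrite (eq_fsbigr (fun i => \sum_(0 <= j < N) t i j)) => [|i _]; last exact: h1.
rewrite (@fsum_ord N) => [|i Ni]; last first.
  by rewrite big1// => j _; apply/t0/(leq_trans Ni)/leq_addr.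
rewrite (@fsum_ord N) => [|s Ns]; last first.
  rewrite big1// => i _; apply: t0; rewrite subnKC// -ltnS; exact: ltn_ord.
rewrite -(big_mkord xpredT (fun i => \sum_(0 <= j < N) t i j)).
have -> : \sum_(s < N) \sum_(i < s.+1) t i (s - i)%N =
    \sum_(0 <= s < N) \sum_(0 <= i < N | (i <= s)%N) t i (s - i)%N.
  rewrite big_mkord; apply: eq_bigr => s _.
  rewrite -(big_mkord xpredT (fun i => t i (s - i)%N)).
  rewrite (big_nat_widen _ _ _ _ _ (ltn_ord s)).
  by apply: eq_bigl => i; rewrite ltnS.
rewrite [RHS](exchange_big_dep_nat xpredT)//=; apply: eq_big_nat => i /andP[_ iN].
rewrite [RHS](big_cat_nat (n := i)) ?(ltnW iN)//= [X in _ = X + _]big_nat_cond.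
rewrite [X in _ = X + _]big1 ?add0r => [|j]; last first.
  by move=> /andP[/andP[_ ji] ij]; move: ji; rewrite ltnNge ij.
rewrite [LHS](big_cat_nat (n := (N - i)%N)) ?leq_subr//=.
rewrite [X in _ + X]big_nat_cond [X in _ + X]big1 ?addr0 => [|j]; last first.
  by rewrite andbT => /andP[+ _]; rewrite leq_subLR => /t0.
transitivity (\sum_(0 + i <= k < N) t i (k - i)%N).
  by rewrite big_addn; apply: eq_bigr => j _; rewrite addnK.
rewrite add0n [LHS]big_nat_cond [RHS]big_nat_cond; apply: eq_bigl => j.
by rewrite andbT; case: (i <= j)%N; rewrite ?andbT ?andbF.
Qed.

End FiniteSums.

(** * Binomial coefficients and complex powers *)

Section Binomials.
Variable R : realType.
Implicit Types (a b : rat) (i n : nat).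
Local Notation binom := (gbinom R).

Lemma gbinom0 a : binom a 0 = 1.
Proof. by rewrite /gbinom big_ord0 fact0 divr1 rmorph1. Qed.

Lemma gbinomS a i : i.+1%:R * binom a i.+1 = ratr (a - i%:R) * binom a i.
Proof.
rewrite /gbinom -[i.+1%:R](ratr_nat R[i]) -!rmorphM /= big_ord_recr factS.
congr ratr; rewrite natrM /=; field.
by rewrite nat1r !pnatr_eq0 -?lt0n fact_gt0.
Qed.

Lemma natSr_unit i : (i.+1%:R : R[i]) != 0.
Proof. by rewrite pnatr_eq0. Qed.

(** Once i + 1 is cancelled, absorption ([gbinomS]) expresses each coefficient by the preceding one,
    so induction on i leaves a polynomial identity. *)
Lemma gbinom_pascal a i : binom (a + 1) i.+1 = binom a i.+1 + binom a i.
Proof.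
elim: i => [|i ih].
  apply: (mulfI (natSr_unit 0)); rewrite mulrDr !gbinomS !gbinom0.
  by rewrite !subr0 !mulr1 rmorphD rmorph1.
apply: (mulfI (natSr_unit i.+1)); rewrite mulrDr !gbinomS ih.
have -> : (i.+2%:R : R[i]) = 1 + i.+1%:R by rewrite -natr1 addrC.
have := gbinomS a i; rewrite !rmorphB !rmorphD !rmorph_nat rmorph1 /=.
rewrite -natr1 => h.
transitivity ((ratr a - i%:R) * binom a i.+1 + (ratr a - i%:R) * binom a i).
  by ring.
by rewrite -h; ring.
Qed.

Lemma gbinom_neg a i : (-1) ^+ i * binom a i = binom (i%:R - 1 - a) i.
Proof.
rewrite /gbinom -[(-1) ^+ i](rmorph_sign (@ratr R[i])) -rmorphM mulrA; congr (ratr (_ / _)).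
rewrite (reindex_inj rev_ord_inj) -[i in (-1) ^+ i]card_ord -prodr_const -big_split.
apply: eq_bigr => j _ /=; rewrite natrB// -natr1; ring.
Qed.

(** After multiplication by n + 1 = i + (n + 1 - i), absorption in each factor gives the weights a -
    i and b - (n - i), whose sum a + b - n does not depend on i. *)
Lemma gbinom_vandermonde a b n :
  \sum_(i < n.+1) binom a i * binom b (n - i) = binom (a + b) n.
Proof.
elim: n => [|n ih]; first by rewrite big_ord1 subnn !gbinom0 mulr1.
apply: (mulfI (natSr_unit n)); rewrite gbinomS -ih !mulr_sumr.
have split_weight (i : 'I_n.+2) : (n.+1%:R : R[i]) = i%:R + (n.+1 - i)%:R.
  by rewrite -natrD subnKC// -ltnS.
under eq_bigr => i _ do rewrite {1}(split_weight i) mulrDl.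
rewrite big_split /= big_ord_recl mul0r add0r [X in _ + X]big_ord_recr /= subnn.
rewrite mul0r addr0 -big_split; apply: eq_bigr => i _ /=.
have iN : (i <= n)%N by rewrite -ltnS.
rewrite /bump /= add1n subSS mulrA gbinomS (subSn iN).
rewrite [X in _ + X = _]mulrCA gbinomS natrB//.
rewrite !rmorphB !rmorphD !rmorph_nat /=; ring.
Qed.

End Binomials.

Section ComplexPowerLaws.
Variable R : realType.
Implicit Types (a b : rat) (x y z : R[i]).

Lemma cexpD x y : cexp (x + y) = cexp x * cexp y.
Proof.
case: x y => [x1 x2] [y1 y2]; rewrite /cexp /= expRD cosD sinD.
by congr Complex; ring.
Qed.

Lemma cexp0 : cexp 0 = 1 :> R[i].
Proof. by rewrite /cexp /= expR0 cos0 sin0 mulr1 mulr0. Qed.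

Lemma cexp_neq0 x : cexp x != 0.
Proof.
apply/eqP => x0; have := cexpD x (- x); rewrite subrr cexp0 x0 mul0r.
by apply/eqP; rewrite oner_eq0.
Qed.

Lemma clogK z : z != 0 -> cexp (clog z) = z.
Proof.
case: z => [a b] z0; rewrite /cexp /clog /carg /=.
set r := cmod _; have r2 : r ^+ 2 = a ^+ 2 + b ^+ 2.
  by rewrite sqr_sqrtr ?addr_ge0 ?sqr_ge0.
have r0 : 0 < r.
  rewrite /r /cmod /= sqrtr_gt0 lt_neqAle addr_ge0 ?sqr_ge0// andbT eq_sym.
  rewrite paddr_eq0 ?sqr_ge0// !sqrf_eq0; apply: contra z0 => /andP[/eqP-> /eqP->].
  by [].
have rN0 : r != 0 by rewrite gt_eqF.
have ar : -1 <= a / r <= 1.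
  rewrite ler_pdivlMr// ler_pdivrMr// mulN1r mul1r -ler_norml.
  rewrite -(ler_pXn2r (n := 2))// ?nnegrE ?(ltW r0)// real_normK ?num_real// r2.
  by rewrite lerDl sqr_ge0.
have sE : sin (acos (a / r)) = `|b| / r.
  rewrite sin_acos// -[RHS]ger0_norm ?divr_ge0 ?(ltW r0)// -sqrtr_sqr.
  congr Num.sqrt; rewrite !expr_div_n real_normK ?num_real//.
  apply: (mulIf (expf_neq0 2 rN0)); rewrite mulrBl !divfK ?expf_neq0// mul1r r2.
  by rewrite addrC addKr.
have cE : cos (acos (a / r)) = a / r by rewrite acosK// in_itv.
rewrite lnK ?posrE//; case: ifP => b0; rewrite /=.
  by rewrite cE sE ger0_norm// !(mulrCA r) !divff ?mulr1.
(* For a negative imaginary part the argument is 2 pi minus the arccosine: the cosine is unchanged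
   and the sine changes sign. *)
rewrite cosB sinB cos2pi sin2pi !mul0r sub0r !mul1r addr0 cE sE.
by rewrite ltr0_norm ?ltNge ?b0// mulNr opprK !(mulrCA r) !divff ?mulr1.
Qed.

Lemma cpowD z a b : cpow z (a + b) = cpow z a * cpow z b.
Proof. by rewrite /cpow rmorphD mulrDl cexpD. Qed.

Lemma cpow0 z : cpow z 0 = 1.
Proof. by rewrite /cpow rmorph0 mul0r cexp0. Qed.

Lemma cpow1 z : z != 0 -> cpow z 1 = z.
Proof. by move=> z0; rewrite /cpow rmorph1 mul1r clogK. Qed.

Lemma epiD a b : epi R (a + b) = epi R a * epi R b.
Proof.
rewrite /epi -cexpD rmorphD mulrDl; congr cexp.
by apply/eqP; rewrite eq_complex /= addr0 !eqxx.
Qed.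

Lemma epi0 : epi R 0 = 1.
Proof. by rewrite /epi rmorph0 mul0r cexp0. Qed.

Lemma epi1 : epi R 1 = -1.
Proof.
rewrite /epi rmorph1 mul1r /cexp /= expR0 cospi sinpi mulr0 mul1r.
by apply/eqP; rewrite eq_complex /= oppr0 !eqxx.
Qed.

Lemma epi_neq0 a : epi R a != 0.
Proof. exact: cexp_neq0. Qed.

Lemma epiN a : epi R (- a) = (epi R a)^-1.
Proof.
apply: (mulfI (epi_neq0 a)); rewrite -epiD subrr epi0 divff//.
exact: epi_neq0.
Qed.

Lemma epi_nat n : epi R n%:R = (-1) ^+ n.
Proof.
elim: n => [|n ih]; first exact: epi0.
by rewrite -natr1 epiD ih epi1 exprSr.
Qed.

Lemma epi_int (n : int) : epi R n%:~R = (-1) ^ n.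
Proof.
case: n => n; first by rewrite -pmulrn epi_nat.
by rewrite NegzE mulrNz epiN -pmulrn epi_nat.
Qed.

End ComplexPowerLaws.

(** * Binomial powers acting on scalar series *)

Definition bounded_above (M : zmodType) (f : rat -> M) : Prop :=
  exists N : rat, forall p, N < p -> f p = 0.

Definition bounded_below (M : zmodType) (f : rat -> M) : Prop :=
  exists N : rat, forall p, p < N -> f p = 0.

Lemma nat_bound (x : rat) : exists N, forall i, (N <= i)%N -> x < i%:R.
Proof.
exists (Num.bound `|x|) => i; rewrite -(ler_nat rat); apply: lt_le_trans.
by apply: le_lt_trans (ler_norm x) _; rewrite archi_boundP.
Qed.

Lemma bounded_above_nat (M : zmodType) (f : rat -> M) p : bounded_above f ->
  exists N, forall i, (N <= i)%N -> f (p + i%:R) = 0.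
Proof.
move=> [B fB]; have [N hN] := nat_bound (B - p); exists N => i /hN.
by rewrite ltrBlDl => /fB.
Qed.

Lemma bounded_below_nat (M : zmodType) (f : rat -> M) p : bounded_below f ->
  exists N, forall i, (N <= i)%N -> f (p - i%:R) = 0.
Proof.
move=> [B fB]; have [N hN] := nat_bound (p - B); exists N => i /hN.
by rewrite ltrBlDl -ltrBlDr => /fB.
Qed.

Section ScalarSeries.
Variables (R : realType) (z : R[i]).
Hypothesis z_neq0 : z != 0.
Local Notation K := (R[i]).
Local Notation binom := (gbinom R).
Implicit Types (f g h : rat -> K) (a b p r : rat) (c s : K).

(* (x + c)^a f(x), for f in descending powers *)
Definition mulxc a c f p : K :=
  \sum_(i \in [set: nat]) binom a i * c ^+ i * f (p - a + i%:R).

(* (z + s x)^a f(x), for f in ascending powers *)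
Definition mulcx a s f p : K :=
  \sum_(i \in [set: nat]) binom a i * cpow z (a - i%:R) * s ^+ i * f (p - i%:R).

(* The coefficient of x_0^r x_1^p in z^-1 delta((x_1 - x_0)/z) h(x_0). *)
Definition deltamul h r p : K :=
  \sum_(i \in [set: nat])
    cpow z (- p - 1 - i%:R) * binom (p + i%:R) i * (-1) ^+ i * h (r - i%:R).

Lemma fin_mulr (u t : nat -> K) : (exists N, forall i, (N <= i)%N -> t i = 0) ->
  exists N, forall i, (N <= i)%N -> u i * t i = 0.
Proof. by move=> [N hN]; exists N => i /hN->; rewrite mulr0. Qed.

Lemma fin_shift (t : nat -> K) : (exists N, forall i, (N <= i)%N -> t i = 0) ->
  exists N, forall i, (N <= i)%N -> t i.+1 = 0.
Proof. by move=> [N hN]; exists N => i Ni; apply/hN/leqW. Qed.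

Lemma mulxc_rec a c f p : bounded_above f ->
  mulxc (a + 1) c f p = mulxc a c f (p - 1) + c * mulxc a c f p.
Proof.
move=> fb; have fin q (u : nat -> K) := @fin_mulr u _ (bounded_above_nat q fb).
rewrite /mulxc fsum_recl; last exact: fin.
rewrite [X in _ = X + _]fsum_recl; last exact: fin.
rewrite !gbinom0 !expr0 mulr_fsumr -[RHS]addrA; congr (_ + _).
  by rewrite [p - (a + 1)](_ : _ = p - 1 - a)//; ring.
rewrite -fsum_split.
- apply: eq_fsbigr => i _; rewrite gbinom_pascal exprS.
  have -> : p - (a + 1) + i.+1%:R = p - a + i%:R by rewrite -natr1; ring.
  have -> : p - 1 - a + i.+1%:R = p - a + i%:R by rewrite -natr1; ring.
  by ring.
- by apply: (@fin_shift (fun i => _ * f (p - 1 - a + i%:R))); exact: fin.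
- have := fin (p - a) (fun i => c * (binom a i * c ^+ i)).
  by move=> [N hN]; exists N => i /hN; rewrite !mulrA.
Qed.

Lemma cpowSr a : cpow z (a + 1) = z * cpow z a.
Proof. by rewrite cpowD cpow1// mulrC. Qed.

Lemma mulcx_rec a s g p : bounded_below g ->
  mulcx (a + 1) s g p = z * mulcx a s g p + s * mulcx a s g (p - 1).
Proof.
move=> gb; have fin q (u : nat -> K) := @fin_mulr u _ (bounded_below_nat q gb).
rewrite /mulcx fsum_recl; last exact: fin.
rewrite [X in _ = z * X + _]fsum_recl; last exact: fin.
rewrite !gbinom0 !expr0 mulrDr !mulr_fsumr -[RHS]addrA !subr0 cpowSr; congr (_ + _).
  by ring.
rewrite -fsum_split.
- apply: eq_fsbigr => i _; rewrite gbinom_pascal exprS.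
  have -> : a + 1 - i.+1%:R = a - i%:R by rewrite -natr1; ring.
  have -> : p - i.+1%:R = p - 1 - i%:R by rewrite -natr1; ring.
  have -> : cpow z (a - i%:R) = z * cpow z (a - i.+1%:R).
    by rewrite -cpowSr; congr cpow; rewrite -natr1; ring.
  by ring.
- have := @fin_shift _ (fin p (fun i => z * (binom a i * cpow z (a - i%:R) * s ^+ i))).
  by move=> [N hN]; exists N => i /hN; rewrite !mulrA.
- have := fin (p - 1) (fun i => s * (binom a i * cpow z (a - i%:R) * s ^+ i)).
  by move=> [N hN]; exists N => i /hN; rewrite !mulrA.
Qed.

(** On the delta function x_1 - x_0 acts as z, so x_1 - z acts as x_0, which moves the exponent of
    x_0 by one. *)
Lemma deltamul_rec h r p : bounded_below h ->
  deltamul h (r - 1) p = deltamul h r (p - 1) - z * deltamul h r p.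
Proof.
move=> hb; have fin q (u : nat -> K) := @fin_mulr u _ (bounded_below_nat q hb).
rewrite -mulNr {2 3}/deltamul mulr_fsumr -fsum_split.
- rewrite [RHS]fsum_recl; last first.
    have := fin r (fun i => cpow z (- (p - 1) - 1 - i%:R) * binom (p - 1 + i%:R) i *
       (-1) ^+ i + - z * (cpow z (- p - 1 - i%:R) * binom (p + i%:R) i * (-1) ^+ i)).
    by move=> [N hN]; exists N => i /hN; rewrite mulrDl !mulrA.
  rewrite !gbinom0 [X in _ = X + _](_ : _ = 0) ?add0r; last first.
    have -> : - (p - 1) - 1 - 0%:R = - p - 1 - 0%:R + 1 by ring.
    by rewrite cpowSr; ring.
  apply: eq_fsbigr => i _.
  have -> : r - 1 - i%:R = r - i.+1%:R by rewrite -natr1; ring.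
  have -> : p + i.+1%:R = p + i%:R + 1 by rewrite -natr1; ring.
  have -> : p - 1 + i.+1%:R = p + i%:R by rewrite -natr1; ring.
  have -> : - (p - 1) - 1 - i.+1%:R = - p - 1 - i.+1%:R + 1 by ring.
  have -> : - p - 1 - i%:R = - p - 1 - i.+1%:R + 1 by rewrite -natr1; ring.
  by rewrite gbinom_pascal cpowSr exprS; ring.
- exact: fin.
- have := fin r (fun i => - z * (cpow z (- p - 1 - i%:R) * binom (p + i%:R) i * (-1) ^+ i)).
  by move=> [N hN]; exists N => i /hN; rewrite !mulrA.
Qed.

(** The residue in x_1 of x_1^b z^(-1) delta((x_1 - x_0)/z) is (z + x_0)^b, so one coefficient in
    x_1 holds a whole binomial power acting on h; [gbinom_neg] matches the binomials. *)
Lemma deltamul_mulcx b h r : deltamul h r (- 1 - b) = mulcx b 1 h r.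
Proof.
apply: eq_fsbigr => i _; rewrite expr1n mulr1.
have -> : - (-1 - b) - 1 - i%:R = b - i%:R by ring.
have -> : binom b i = (-1) ^+ i * binom (- 1 - b + i%:R) i.
  by rewrite gbinom_neg; congr gbinom; ring.
by ring.
Qed.

Lemma mulcx_bounded b s g N : (forall p, p < N -> g p = 0) ->
  forall p, p < N -> mulcx b s g p = 0.
Proof.
move=> gN p pN; rewrite /mulcx fsbig1// => i _; rewrite gN ?mulr0//.
by apply: le_lt_trans pN; rewrite lerBlDr lerDl.
Qed.

Lemma gbinom_0n n : binom 0 n = (n == 0%N)%:R.
Proof.
case: n => [|n]; first by rewrite gbinom0.
by rewrite /gbinom big_ord_recl subrr mul0r mul0r rmorph0.
Qed.

(** By Vandermonde the two binomial series multiply to (z + s x)^0; the lower bound on g makes the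
    double sum finite. *)
Lemma mulcxK b s g p : bounded_below g -> mulcx (- b) s (mulcx b s g) p = g p.
Proof.
move=> gb; have [N hN] := bounded_below_nat p gb.
transitivity (\sum_(i \in [set: nat]) \sum_(j \in [set: nat])
    binom (- b) i * binom b j * (cpow z (- (i + j)%:R) * s ^+ (i + j) *
      g (p - (i + j)%:R))).
  apply: eq_fsbigr => i _; rewrite /mulcx mulr_fsumr; apply: eq_fsbigr => j _.
  have -> : - (i + j)%:R = (- b - i%:R) + (b - j%:R) by rewrite natrD; ring.
  have -> : p - i%:R - j%:R = p + ((- b - i%:R) + (b - j%:R)) by ring.
  by rewrite (cpowD z (- b - i%:R)) exprD; ring.
rewrite (@fsum_antidiagonal _ _ N) => [|i j ij]; last by rewrite hN ?mulr0.
rewrite (@fsum_only _ _ 0%N) => [|n nN0].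
  by rewrite big_ord1 !subnn addn0 !gbinom0 oppr0 cpow0 expr0 !mul1r subr0.
under eq_bigr => i _ do rewrite (subnKC (leq_ord i)).
rewrite -mulr_suml gbinom_vandermonde addNr.
by rewrite gbinom_0n; case: n nN0 => // n _; rewrite mul0r.
Qed.

(** The residue substitution: the left side is the coefficient of x^r in (x + z)^b f(x + z).
    Vandermonde sums the terms of fixed i + j, and [gbinom_neg] turns the result into binomials of
    -1 - r. *)
Lemma translate_mulxc b f r : bounded_above f ->
  \sum_(j \in [set: nat]) binom b j * z ^+ j *
    \sum_(i \in [set: nat]) binom (r - b + j%:R + i%:R) i * z ^+ i *
      f (r - b + j%:R + i%:R) = mulxc (- 1 - r) (- z) f (- 1 - b).
Proof.
move=> fb; have [N hN] := bounded_above_nat (r - b) fb.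
transitivity (\sum_(j \in [set: nat]) \sum_(i \in [set: nat])
    binom b j * binom (r - b + (j + i)%:R) i *
      (z ^+ (j + i) * f (r - b + (j + i)%:R))).
  apply: eq_fsbigr => j _; rewrite mulr_fsumr; apply: eq_fsbigr => i _.
  by rewrite natrD addrA exprD; ring.
rewrite (@fsum_antidiagonal _ _ N) => [|i j ij]; last by rewrite hN ?mulr0.
apply: eq_fsbigr => n _.
under eq_bigr => i _ do rewrite (subnKC (leq_ord i)).
rewrite -mulr_suml gbinom_vandermonde exprNn.
have -> : b + (r - b + n%:R) = n%:R - 1 - (- 1 - r) by ring.
have -> : - 1 - b - (- 1 - r) = r - b by ring.
by rewrite -gbinom_neg; ring.
Qed.

End ScalarSeries.

(** * Arrays obeying the recurrence of multiplication by x + c *)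

Section Recurrences.
Variables (K : fieldType) (c : K) (E : rat -> rat -> K).
Hypothesis c_neq0 : c != 0.
Hypothesis E_rec : forall b r, E (b + 1) r = E b (r - 1) + c * E b r.
Implicit Types (b r : rat).

Lemma rec_zero b d : (forall r, E b r = 0) -> forall r, E (b + d%:R) r = 0.
Proof.
move=> b0; elim: d => [|d ih] r; first by rewrite addr0.
by rewrite -natr1 addrA E_rec !ih mulr0 addr0.
Qed.

Lemma rec_bounded b d N : (forall r, r < N -> E b r = 0) ->
  forall r, r < N -> E (b + d%:R) r = 0.
Proof.
move=> b0; elim: d => [|d ih] r rN; first by rewrite addr0 b0.
by rewrite -natr1 addrA E_rec !ih ?mulr0 ?addr0// (lt_trans _ rN)// gtrBl.
Qed.

(** When x + c kills the series, each coefficient is a multiple of the one a unit below it, c being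
    invertible; unit steps down end where the series vanishes. *)
Lemma rec_bounded_zero b : bounded_below (E b) ->
  (forall r, E (b + 1) r = 0) -> forall r, E b r = 0.
Proof.
move=> [N bN] b1 r.
have back q : E b (q - 1) = 0 -> E b q = 0.
  move=> q0; have := b1 q; rewrite E_rec q0 add0r => /eqP.
  by rewrite mulf_eq0 (negPf c_neq0) => /eqP.
have {}back n q : E b (q - n%:R) = 0 -> E b q = 0.
  elim: n q => [|n ih] q; first by rewrite subr0.
  by rewrite -natr1 opprD addrA addrAC => /ih/back.
have [n hn] := nat_bound (r - N); apply: (back n); apply: bN.
by rewrite ltrBlDr -ltrBlDl; apply: hn.
Qed.

(* Multiplication by x + c is injective on series bounded below. *)
Lemma rec_regress b d : bounded_below (E b) ->
  (forall r, E (b + d%:R) r = 0) -> forall r, E b r = 0.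
Proof.
move=> bb; elim: d => [|d ih]; first by rewrite addr0.
rewrite -natr1 addrA => bd; apply: ih; apply: rec_bounded_zero => //.
by have [N bN] := bb; exists N; exact: rec_bounded.
Qed.

(* A doubly infinite series killed by x + c is determined by one coefficient. *)
Lemma rec_descent b r : (forall d r', E (b + d%:R) r' = 0) ->
  (forall n : int, E (b + n%:~R) r = 0) ->
  forall n m : int, E (b + n%:~R) (r + m%:~R) = 0.
Proof.
move=> bd br [] n m; first by rewrite -pmulrn.
rewrite NegzE mulrNz -pmulrn; elim: n.+1 m => {n} [|n ih] m.
  by have := bd 0%N (r + m%:~R); rewrite ?addr0 ?subr0.
set a := b - _; have aS : a + 1 = b - n%:R by rewrite /a -natr1; ring.
have step q : E a (q - 1) + c * E a q = E (b - n%:R) q by rewrite -E_rec aS.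
have a0 : E a r = 0 by rewrite /a -[n.+1%:R]/(n.+1%:Z%:~R) -mulrNz br.
(* Above r a coefficient follows from the one below it after division by c; below r it follows from
   the one above it without division. *)
case: m => m.
  rewrite -pmulrn; elim: m => [|m ihm]; first by rewrite addr0.
  have := step (r + m.+1%:R); rewrite [r + m.+1%:R - 1](_ : _ = r + m%:R); last first.
    by rewrite -natr1; ring.
  rewrite ihm add0r -[m.+1%:R]/(m.+1%:Z%:~R) ih => /eqP.
  by rewrite mulf_eq0 (negPf c_neq0) => /eqP.
rewrite NegzE mulrNz -pmulrn; elim: m.+1 => {m} [|m ihm]; first by rewrite subr0.
have := step (r - m%:R); rewrite ihm mulr0 addr0 -[m%:R]/(m%:Z%:~R) -mulrNz ih.
by rewrite mulrNz -[_%:~R]/(m%:R) [r - m%:R - 1](_ : _ = r - m.+1%:R) // -natr1; ring.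
Qed.

End Recurrences.

(** * Delta functions and convolutions reduced to binomial powers *)

Section SeriesExpansions.
Variables (R : realType) (z : R[i]).
Local Notation K := (R[i]).
Local Notation binom := (gbinom R).
Implicit Types (f g h : rat -> K) (a b p r al be : rat) (c s : K).

Lemma mono_inj (F : nat -> K) (e : nat -> rat) i : injective e ->
  \sum_(j \in [set: nat]) F j * mono R (e j) (e i) = F i.
Proof.
move=> eI; rewrite (@fsum_only _ _ i) /mono ?eqxx ?mulr1// => j ji.
by case: eqP => [/eI/esym//|]; rewrite mulr0.
Qed.

Lemma mono_out (I : choiceType) (F : I -> K) (e : I -> rat) p :
  (forall i, e i <> p) -> \sum_(j \in [set: I]) F j * mono R (e j) p = 0.
Proof.
move=> ep; rewrite fsbig1// => j _; rewrite /mono; case: eqP; rewrite ?mulr0//.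
by move/esym/ep.
Qed.

Lemma subr_nat_inj a : injective (fun i : nat => a - i%:R).
Proof. by move=> i j /addrI/oppr_inj/eqP; rewrite eqr_nat => /eqP. Qed.

Lemma natr_rat_inj : injective (fun i : nat => i%:R : rat).
Proof. by move=> i j /eqP; rewrite eqr_nat => /eqP. Qed.

Lemma sum_pow_xc a c f p :
  \sum_(q \in [set: rat]) pow_xc a c q * f (p - q) = mulxc a c f p.
Proof.
rewrite (@fsum_reindex _ _ _ _ _ (@subr_nat_inj a)) => [|q aq]; last first.
  by rewrite /pow_xc mono_out ?mul0r.
apply: eq_fsbigr => i _; rewrite /pow_xc (@mono_inj _ _ i (@subr_nat_inj a)).
by congr (_ * f _); ring.
Qed.

Lemma sum_pow_cx a s g p :
  \sum_(q \in [set: rat]) pow_cx z a s q * g (p - q) = mulcx z a s g p.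
Proof.
rewrite (@fsum_reindex _ _ _ _ _ natr_rat_inj) => [|q aq]; last first.
  by rewrite /pow_cx mono_out ?mul0r.
by apply: eq_fsbigr => i _; rewrite /pow_cx (@mono_inj _ _ i natr_rat_inj).
Qed.

Lemma delta_exponent_inj al : injective (fun n : int => - n%:~R - 1 - al : rat).
Proof.
by move=> m n /addIr/addIr/oppr_inj/eqP; rewrite eqr_int => /eqP.
Qed.

Lemma delta_xzE al (n : int) p :
  delta_xz z al (- n%:~R - 1 - al) p = pow_xc (n%:~R + al) (- z) p.
Proof.
rewrite /delta_xz (@fsum_only _ _ n) /mono ?eqxx ?mul1r// => m mn.
by case: eqP => [/delta_exponent_inj/esym//|]; rewrite mul0r.
Qed.

Lemma delta_zxNE al (n : int) p :
  delta_zxN z al (- n%:~R - 1 - al) p = (-1) ^ n * pow_cx z (n%:~R + al) (-1) p.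
Proof.
rewrite /delta_zxN (@fsum_only _ _ n) /mono ?eqxx ?mulr1// => m mn.
by case: eqP => [/delta_exponent_inj/esym//|]; rewrite mulr0 mul0r.
Qed.

Lemma delta_exponentP al r : r + al \isn't a Num.int ->
  forall n : int, - n%:~R - 1 - al <> r.
Proof.
move=> /negP ri n E; apply: ri; rewrite -E subrK.
by rewrite rpredB ?rpred1// rpredN intr_int.
Qed.

Lemma delta_xz_out al r p : r + al \isn't a Num.int -> delta_xz z al r p = 0.
Proof.
move=> /delta_exponentP ri; rewrite /delta_xz fsbig1// => n _; rewrite /mono.
by case: eqP => [/esym/ri//|]; rewrite mul0r.
Qed.

Lemma delta_zxN_out al r p : r + al \isn't a Num.int -> delta_zxN z al r p = 0.
Proof.
move=> /delta_exponentP ri; rewrite /delta_zxN fsbig1// => n _; rewrite /mono.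
by case: eqP => [/esym/ri//|]; rewrite mulr0 mul0r.
Qed.

Lemma pow_xx_nat b s p i :
  pow_xx b s p i%:R = binom b i * s ^+ i * mono R (b - i%:R) p.
Proof.
exact: (@mono_inj (fun j => binom b j * s ^+ j * mono R (b - j%:R) p) _ i natr_rat_inj).
Qed.

Lemma pow_xx_out b s p q : (forall i : nat, i%:R <> q) -> pow_xx b s p q = 0.
Proof.
exact: (@mono_out _ (fun j => binom b j * s ^+ j * mono R (b - j%:R) p)).
Qed.

Lemma sum_delta_xx_at be h r p : p + be \is a Num.int ->
  \sum_(q \in [set: rat]) delta_xx_at z (- be) p q * h (r - q) = deltamul z h r p.
Proof.
move=> /intrP [m pm]; rewrite (@fsum_reindex _ _ _ _ _ natr_rat_inj) => [|q aq].
  apply: eq_fsbigr => i _; congr (_ * _); rewrite /delta_xx_at.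
  have E : (m + i)%:~R - be = p + i%:R.
    by rewrite rmorphD /= -pm; ring.
  (* With x_0 to the power i, the exponent p of x_1 forces n - be - i = p, that is n = m + i for m =
     p + be. *)
  rewrite (@fsum_only _ _ (m + i)) => [|n nm]; rewrite pow_xx_nat.
    rewrite E [p + i%:R - _]addrK /mono eqxx mulr1 mulrA; congr (cpow z _ * _ * _).
    by rewrite rmorphD /= -pm; ring.
  rewrite /mono; case: eqP => [pE|_]; last by rewrite !mulr0.
  case: nm; apply: (@intr_inj rat); rewrite rmorphD /= -pm pE; ring.
rewrite /delta_xx_at fsbig1 ?mul0r// => n _.
by rewrite pow_xx_out ?mulr0.
Qed.

Lemma sum_delta_xx_at_out be h r p : p + be \isn't a Num.int ->
  \sum_(q \in [set: rat]) delta_xx_at z (- be) p q * h (r - q) = 0.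
Proof.
move=> /negP pi; rewrite fsbig1// => q _; rewrite /delta_xx_at fsbig1 ?mul0r// => n _.
rewrite /pow_xx fsbig1 ?mulr0// => i _; rewrite /mono; case: eqP => [pE|_].
  by case: pi; rewrite pE addrAC subrK rpredB ?intr_int ?natr_int.
by rewrite mulr0 mul0r.
Qed.

Lemma sum_delta_xx_at_coset al be h r p :
  (forall q, q + al \isn't a Num.int -> h q = 0) -> r + al \isn't a Num.int ->
  \sum_(q \in [set: rat]) delta_xx_at z (- be) p q * h (r - q) = 0.
Proof.
move=> hs ri; rewrite fsbig1// => q _.
case: (pselect (exists i : nat, i%:R = q)) => [[i <-]|qN].
  rewrite hs ?mulr0//; apply: contra ri => ri.
  by rewrite -[r](subrK (i%:R)) addrAC rpredD ?natr_int.
rewrite /delta_xx_at fsbig1 ?mul0r// => n _; rewrite pow_xx_out ?mulr0// => i iq.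
by apply: qN; exists i.
Qed.

Lemma mulxc_coset a c f p e : (forall q, q + e \isn't a Num.int -> f q = 0) ->
  p - a + e \isn't a Num.int -> mulxc a c f p = 0.
Proof.
move=> fs pi; rewrite /mulxc fsbig1// => i _; rewrite fs ?mulr0//.
apply: contra pi => pi; rewrite -[p - a](addrK i%:R) addrAC.
by rewrite rpredB ?natr_int.
Qed.

Lemma mulcx_coset a s g p e : (forall q, q + e \isn't a Num.int -> g q = 0) ->
  p + e \isn't a Num.int -> mulcx z a s g p = 0.
Proof.
move=> gs pi; rewrite /mulcx fsbig1// => i _; rewrite gs ?mulr0//.
by apply: contra pi => pi; rewrite -[p](subrK i%:R) addrAC rpredD ?natr_int.
Qed.

(** The supports lie in cosets of the integers, off which every term vanishes. On them the exponent
    of x_0 is -1 - a with a = n + al, and the sign (-1)^n of the second delta function joins e^(al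
    pi i) to form e^(a pi i). *)
Lemma intertwining_coset al be f g h :
  (forall q, q + (al + be) \isn't a Num.int -> f q = 0) ->
  (forall q, q + be \isn't a Num.int -> g q = 0) ->
  (forall q, q + al \isn't a Num.int -> h q = 0) ->
  (forall r p, \sum_(q \in [set: rat]) delta_xz z al r q * f (p - q)
     - epi R al * \sum_(q \in [set: rat]) delta_zxN z al r q * g (p - q) =
     \sum_(q \in [set: rat]) delta_xx_at z (- be) p q * h (r - q)) <->
  (forall a p, a - al \is a Num.int -> p + be \is a Num.int ->
     mulxc a (- z) f p - epi R a * mulcx z a (-1) g p = deltamul z h (- 1 - a) p).
Proof.
move=> fs gs hs.
have lhsE a p : a - al \is a Num.int ->
    \sum_(q \in [set: rat]) delta_xz z al (- 1 - a) q * f (p - q)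
     - epi R al * \sum_(q \in [set: rat]) delta_zxN z al (- 1 - a) q * g (p - q) =
    mulxc a (- z) f p - epi R a * mulcx z a (-1) g p.
  move=> /intrP [n an].
  have rE : - 1 - a = - n%:~R - 1 - al by rewrite -an; ring.
  have aE : a = n%:~R + al by rewrite -an subrK.
  congr (_ - _).
    rewrite -sum_pow_xc; apply: eq_fsbigr => q _.
    by rewrite rE delta_xzE -aE.
  have -> : epi R a = epi R al * (-1) ^ n by rewrite aE epiD epi_int mulrC.
  rewrite -mulrA; congr (_ * _).
  rewrite -sum_pow_cx mulr_fsumr; apply: eq_fsbigr => q _.
  by rewrite rE delta_zxNE -aE mulrA.
split=> [J a p ai pi|J r p].
  by rewrite -lhsE// J sum_delta_xx_at.
case: (boolP (r + al \is a Num.int)) => ri; last first.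
  rewrite (sum_delta_xx_at_coset _ _ hs ri) !fsbig1 ?mulr0 ?subr0// => q _.
    by rewrite delta_zxN_out ?mul0r.
  by rewrite delta_xz_out ?mul0r.
pose a := - 1 - r; have rE : r = - 1 - a by rewrite /a; ring.
have ai : a - al \is a Num.int.
  have -> : a - al = - 1 - (r + al) by rewrite /a; ring.
  by rewrite rpredB// rpredN rpred1.
have := lhsE a p ai; rewrite -rE => ->; case: (boolP (p + be \is a Num.int)) => pi.
  by rewrite J// -rE sum_delta_xx_at.
rewrite sum_delta_xx_at_out// (mulxc_coset _ fs) ?(mulcx_coset _ _ gs pi) ?mulr0 ?subr0//.
apply: contra pi => pi.
have -> : p + be = (p - a + (al + be)) + (a - al) by ring.
exact: rpredD.
Qed.

End SeriesExpansions.

Lemma laurent_xshiftE (U : zmodType) (a : rat) (f : rat -> U) :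
  laurent (xshift a f) <->
  (forall p, p + a \isn't a Num.int -> f p = 0) /\ bounded_below f.
Proof.
split=> [[fs [N fN]]|[fs [B fB]]].
  split=> [p /fs|]; first by rewrite /xshift addrK.
  exists (N%:~R - a) => p; rewrite ltrBrDr => /fN.
  by rewrite /xshift addrK.
split=> [p pi|]; first by rewrite /xshift fs// subrK.
have [n hn] := nat_bound (- (B + a)); exists (- n%:Z) => p pn; apply: fB.
rewrite ltrBlDr; apply: lt_trans pn _.
by rewrite mulrNz ltrNl; apply: hn.
Qed.

Section LinearFunctions.
Variables (K : pzRingType) (U X : lmodType K) (f : U -> X).
Hypothesis f_lin : linear f.

Lemma linear_fun0 : f 0 = 0.
Proof. by have := f_lin (-1) 0 0; rewrite scaler0 addr0 scaleN1r addNr. Qed.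

Lemma linear_funD u v : f (u + v) = f u + f v.
Proof. by have := f_lin 1 u v; rewrite !scale1r. Qed.

Lemma linear_funZ a u : f (a *: u) = a *: f u.
Proof. by have := f_lin a u 0; rewrite !addr0 linear_fun0 addr0. Qed.

Lemma linear_funB u v : f (u - v) = f u - f v.
Proof. by rewrite linear_funD -scaleN1r linear_funZ scaleN1r. Qed.

Lemma linear_fun_sum (I : Type) (r : seq I) (F : I -> U) :
  f (\sum_(i <- r) F i) = \sum_(i <- r) f (F i).
Proof.
by elim/big_rec2: _ => [|i y x _ <-]; rewrite ?linear_fun0// linear_funD.
Qed.

End LinearFunctions.

Lemma fsum_finite_seq (M : zmodType) (I : choiceType) (c : I -> M) :
  finite_set [set i | c i != 0] ->
  exists r, [/\ uniq r, forall i, i \notin r -> c i = 0 &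
    \sum_(i \in [set: I]) c i = \sum_(i <- r) c i].
Proof.
move=> /finite_fsetP[A cA].
have c0 i : i \notin A -> c i = 0.
  move=> iA; apply/eqP/negPn; apply: contra iA => ci.
  have : [set i | c i != 0] i by [].
  by rewrite cA.
by exists A; split=> //; rewrite (@fsum_seq _ _ A).
Qed.

(** * Weights and the opposite vertex operators *)

Section IntegralEigenvectors.
Variables (R : realType) (U : lmodType R[i]) (L : U -> U).
Hypothesis L_lin : linear L.

Lemma eigenvectors_free (c : int -> U) (r : seq int) :
  (forall n, L (c n) = n%:~R *: c n) -> uniq r -> \sum_(n <- r) c n = 0 ->
  forall n, n \in r -> c n = 0.
Proof.
elim: r c => [//|m r ih] c cL /andP[mr ur]; rewrite big_cons => c0.
have cr n : n \in r -> c n = 0.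
  (* The image of the family under L - m: the term of index m is lost and each other one is
     multiplied by k - m, which is nonzero. *)
  move=> nr; pose d k := ((k - m)%:~R : R[i]) *: c k.
  have dL k : L (d k) = k%:~R *: d k.
    by rewrite /d (linear_funZ L_lin) cL !scalerA mulrC.
  have d0 : \sum_(k <- r) d k = 0.
    have := congr1 (fun x => L x - m%:~R *: x) c0.
    rewrite /= (linear_fun0 L_lin) scaler0 subr0 (linear_funD L_lin) cL scalerDr opprD addrACA subrr.
    rewrite add0r (linear_fun_sum L_lin) scaler_sumr -sumrB => h; rewrite -[RHS]h {h}.
    by apply: eq_bigr => k _; rewrite cL /d rmorphB scalerBl.
  have /eqP := ih _ dL ur d0 n nr; rewrite scaler_eq0 intr_eq0 subr_eq0.
  by case/orP=> [/eqP nm|/eqP//]; move: mr; rewrite -nm nr.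
move=> n; rewrite inE => /orP[/eqP->|/cr//].
by move: c0; rewrite big_seq big1 ?addr0.
Qed.

End IntegralEigenvectors.

Section Weights.
Variables (R : realType) (V : voa R).
Implicit Types (v : V) (n : int).

Lemma voaL_linear n : linear (@voaL R V n).
Proof. exact: Yvoa_linear_r. Qed.

Lemma wt_compP v : [/\ forall n, voaL 0 (wt_comp v n) = n%:~R *: wt_comp v n,
  finite_set [set n | wt_comp v n != 0] &
  v = \sum_(n \in [set: int]) wt_comp v n].
Proof. exact: (projT2 (cid (voa_graded v))). Qed.

(** The differences of the two sides have weight n and sum to zero, so independence of weights kills
    each. Hence the weight components of an eigenvector stay in its eigenspace, where the exponents
    of [Ytm] are known. *)
Lemma wt_comp_eigen (phi : V -> V) (lam : R[i]) v : linear phi ->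
  (forall u, phi (voaL 0 u) = voaL 0 (phi u)) -> phi v = lam *: v ->
  forall n, phi (wt_comp v n) = lam *: wt_comp v n.
Proof.
move=> philin phiL phiv n; have [cL cf vE] := wt_compP v.
have [r [ur r0 rE]] := fsum_finite_seq cf.
pose d k := phi (wt_comp v k) - lam *: wt_comp v k.
have dL k : voaL 0 (d k) = k%:~R *: d k.
  rewrite (linear_funB (voaL_linear 0)) (linear_funZ (voaL_linear 0)) -phiL cL.
  by rewrite (linear_funZ philin) scalerBr !scalerA mulrC.
have d0 : \sum_(k <- r) d k = 0.
  by rewrite sumrB -(linear_fun_sum philin) -scaler_sumr -rE -vE phiv subrr.
apply/eqP; rewrite -subr_eq0; apply/eqP.
have [nr|/r0 n0] := boolP (n \in r).
  exact: (eigenvectors_free (voaL_linear 0) dL ur d0).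
by rewrite n0 (linear_fun0 philin) scaler0 subr0.
Qed.

Lemma voaL1_weight n v : voaL 0 v = n%:~R *: v ->
  voaL 0 (voaL 1 v) = (n - 1)%:~R *: voaL 1 v.
Proof.
move=> vn; have := voa_virasoro 0 1 v; rewrite vn (linear_funZ (voaL_linear 1)).
rewrite !add0r /= scale0r addr0 => /eqP; rewrite subr_eq => /eqP ->.
by rewrite -scalerDl -rmorphD /= addrC.
Qed.

Lemma iter_voaL1_weight n m v : voaL 0 v = n%:~R *: v ->
  voaL 0 (iter m (voaL 1) v) = (n - m%:Z)%:~R *: iter m (voaL 1) v.
Proof.
move=> vn; elim: m => [|m ih]; first by rewrite subr0.
by rewrite iterS (voaL1_weight ih); congr (_%:~R *: _); rewrite -addn1 PoszD; ring.
Qed.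

Lemma iter_voaL1_zero v m : v = 0 -> iter m (voaL 1) v = 0.
Proof.
by move=> ->; elim: m => //= m ->; exact: linear_fun0 (voaL_linear 1).
Qed.

(** The m-th iterate has weight n - m, and weights below N do not occur. *)
Lemma iter_voaL1_nilpotent n v : voaL 0 v = n%:~R *: v ->
  exists M, forall m, (M <= m)%N -> iter m (voaL 1) v = 0.
Proof.
have [N hN] := voa_truncated V => vn; exists `|n - N|.+1%N => m Mm.
apply: (hN (n - m%:Z)); last exact: iter_voaL1_weight.
rewrite ltrBlDr -ltrBlDl; apply: (le_lt_trans (lez_abs _)).
by rewrite ltz_nat.
Qed.

Lemma Yopp_support_finite v : exists r : seq (int * nat), uniq r /\
  forall e, e \notin r -> iter e.2 (voaL 1) (wt_comp v e.1) = 0.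
Proof.
have [cL cf _] := wt_compP v; have [r [ur r0 _]] := fsum_finite_seq cf.
have [M hM] : exists M, forall n m, n \in r -> (M <= m)%N ->
    iter m (voaL 1) (wt_comp v n) = 0.
  elim: r {ur r0} => [|n r [M hM]]; first by exists 0%N.
  have [M' hM'] := iter_voaL1_nilpotent (cL n); exists (maxn M M') => k m.
  rewrite inE geq_max => /orP[/eqP->|kr] /andP[h1 h2]; first exact: hM'.
  exact: hM.
exists [seq (n, m) | n <- r, m <- iota 0 M]; split.
  by apply: allpairs_uniq; rewrite ?iota_uniq// => -[? ?] [? ?] _ _ /=.
move=> [n m] /= /allpairsP nm; have [nr|/r0 n0] := boolP (n \in r).
  apply: hM => //; rewrite leqNgt; apply/negP => mM; apply: nm.
  by exists (n, m); rewrite mem_iota.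
by rewrite n0 iter_voaL1_zero.
Qed.

End Weights.

Section Automorphisms.
Variables (R : realType) (V : voa R) (T : nat).
Implicit Types (s : V -> V) (v : V) (j : int).

Lemma aut_voaL s n v : voa_aut s -> s (voaL n v) = voaL n (s v).
Proof. by move=> hs; rewrite [LHS](aut_Y hs) (aut_conf hs). Qed.

Lemma eigen_iter_voaL1 s j v n m : voa_aut s -> eigen T s j v ->
  eigen T s j (iter m (voaL 1) (wt_comp v n)).
Proof.
move=> hs sv; elim: m => [|m ih] /=.
  exact: (wt_comp_eigen (aut_linear hs)) (fun u => aut_voaL _ u hs) sv n.
by rewrite /eigen aut_voaL// ih (linear_funZ (@voaL_linear R V 1)).
Qed.

Lemma eigen_vac s : voa_aut s -> eigen T s 0 (vac V).
Proof. by move=> hs; rewrite /eigen (aut_vac hs) /qfrac mul0r mulr0 epi0 scale1r. Qed.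

Lemma qfracD i j : qfrac T (i + j) = qfrac T i + qfrac T j.
Proof. by rewrite /qfrac rmorphD mulrDl. Qed.

Lemma qfracN j : qfrac T (- j) = - qfrac T j.
Proof. by rewrite /qfrac rmorphN mulNr. Qed.

Lemma eigen2_inverse s1 s2 s i j v : voa_aut s1 -> voa_aut s2 ->
  cancel (s1 \o s2) s -> eigen2 T s1 s2 i j v -> eigen T s (- (i + j)) v.
Proof.
move=> a1 a2 Ks [v1 v2]; rewrite /eigen; set lam := epi _ _.
have -> : s v = s ((s1 \o s2) (lam *: v)); last by rewrite Ks.
congr s; rewrite /= (linear_funZ (aut_linear a2)) (linear_funZ (aut_linear a1)).
rewrite v2 (linear_funZ (aut_linear a1)) v1 !scalerA -!epiD -[LHS]scale1r.
by congr (_ *: _); rewrite -(epi0 R) qfracN qfracD; congr epi; ring.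
Qed.

End Automorphisms.

Section TwistedModules.
Variables (R : realType) (V : voa R) (T : nat) (s : V -> V) (W : twisted_module T s).
Implicit Types (v : V) (w : W) (p q : rat).

Lemma Ytm0r v p : Ytm v p (0 : W) = 0.
Proof. exact: linear_fun0 (@Ytm_linear_r _ _ _ _ W v p). Qed.

Lemma Ytm0l p w : Ytm (0 : V) p w = 0.
Proof. exact: linear_fun0 (@Ytm_linear_l _ _ _ _ W p w). Qed.

Lemma Ytm_eigen j v w : eigen T s j v ->
  (forall p, p + qfrac T j \isn't a Num.int -> Ytm v p w = 0) /\
  bounded_below (fun p => Ytm v p w).
Proof. by move=> sv; apply/laurent_xshiftE; exact: Ytm_laurent. Qed.

End TwistedModules.

Section OppositeOperators.
Variables (R : realType) (V : voa R) (T : nat) (s1 s2 s : V -> V).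
Hypotheses (aut1 : voa_aut s1) (aut2 : voa_aut s2) (Ks : cancel (s1 \o s2) s).
Variable W : twisted_module T s.
Implicit Types (v : V) (w : W) (p : rat) (j : int).

(** The list depends on v alone and serves all p and w; the bound in [Yopp_bounded] is built along
    it. *)
Lemma YoppE v : exists2 r : seq (int * nat),
  (forall e, e \notin r -> iter e.2 (voaL 1) (wt_comp v e.1) = 0) &
  forall p w, Yopp v p w = \sum_(e <- r) ((-1) ^ e.1 / e.2`!%:R : R[i]) *:
    Ytm (iter e.2 (voaL 1) (wt_comp v e.1)) (e.2%:R - 2 * e.1%:~R - p) w.
Proof.
have [r [ur r0]] := Yopp_support_finite v; exists r => // p w.
by rewrite /Yopp (@fsum_seq _ _ r)// => e /r0->; rewrite Ytm0l scaler0.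
Qed.

Lemma Yopp0 v p : Yopp v p (0 : W) = 0.
Proof. by rewrite /Yopp fsbig1// => e _; rewrite Ytm0r scaler0. Qed.

Lemma Yopp_coset j1 j2 v p w : eigen2 T s1 s2 j1 j2 v ->
  p + (qfrac T j1 + qfrac T j2) \isn't a Num.int -> Yopp v p w = 0.
Proof.
move=> hv pi; rewrite /Yopp fsbig1// => -[n m] _ /=.
have hu : eigen T s (- (j1 + j2)) (iter m (voaL 1) (wt_comp v n)).
  by apply: (eigen2_inverse aut1 aut2 Ks); case: hv => *; split; exact: eigen_iter_voaL1.
have [-> //] := Ytm_eigen w hu; rewrite ?scaler0//.
apply: contra pi; rewrite qfracN qfracD => qi.
set al := qfrac T j1 + qfrac T j2 in qi *.
have -> : p + al = m%:R - 2 * n%:~R - (m%:R - 2 * n%:~R - p - al) by ring.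
by rewrite rpredB// rpredB ?natr_int// rpredM ?intr_int// natr_int.
Qed.

(** Passing to x^(-1) turns lower truncation into upper truncation; hence (x - z)^a, in descending
    powers of x, acts on [Ystar] by finite sums. *)
Lemma Yopp_bounded j1 j2 v w : eigen2 T s1 s2 j1 j2 v ->
  bounded_above (fun p => Yopp v p w).
Proof.
move=> hv; have [r _ rE] := YoppE v.
have [B hB] : exists B : rat, forall e, e \in r -> forall p, B < p ->
    Ytm (iter e.2 (voaL 1) (wt_comp v e.1)) (e.2%:R - 2 * e.1%:~R - p) w = 0.
  elim: r {rE} => [|[n m] r [B hB]]; first by exists 0.
  have hu : eigen T s (- (j1 + j2)) (iter m (voaL 1) (wt_comp v n)).
    by apply: (eigen2_inverse aut1 aut2 Ks); case: hv => *; split; exact: eigen_iter_voaL1.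
  have [_ [N hN]] := Ytm_eigen w hu.
  exists (Num.max B (m%:R - 2 * n%:~R - N)) => e.
  rewrite inE => /orP[/eqP->|er] p; rewrite gt_max => /andP[h1 h2]; last exact: hB.
  by apply: hN; rewrite /= ltrBlDr -ltrBlDl.
exists B => p Bp; rewrite rE big_seq big1// => e er.
by rewrite hB ?scaler0.
Qed.

(** [wt_comp] comes from a choice of decomposition, so its value on the vacuum rests on uniqueness
    of weight components. *)
Lemma wt_comp_vac n : wt_comp (vac V) n = if n == 0 then vac V else 0.
Proof.
have [cL cf vE] := wt_compP (vac V); have [r [ur r0 rE]] := fsum_finite_seq cf.
have L0 : voaL 0 (vac V) = 0.
  by rewrite [LHS]Yvoa_creation//= subr_le0.
pose d k := wt_comp (vac V) k - (if k == 0 then vac V else 0).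
have dL k : voaL 0 (d k) = k%:~R *: d k.
  rewrite /d (linear_funB (@voaL_linear R V 0)) cL; case: eqP => [->|_].
    by rewrite L0 !scale0r subr0.
  by rewrite (linear_fun0 (@voaL_linear R V 0)) !subr0.
(* The support list of the chosen decomposition is not known to contain 0. *)
pose t := undup (0 :: r).
have dt : \sum_(k <- t) d k = 0.
  rewrite sumrB [X in _ - X](_ : _ = vac V); last first.
    rewrite (bigD1_seq 0) ?undup_uniq ?mem_undup ?mem_head//= big1 ?addr0// => k.
    by move=> /negPf->.
  rewrite -(@fsum_seq _ _ t) ?undup_uniq// => [|k].
    by rewrite -vE subrr.
  by rewrite mem_undup inE negb_or => /andP[_ /r0].
apply/eqP; rewrite -subr_eq0; apply/eqP.
have [nt|] := boolP (n \in t).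
  exact: (eigenvectors_free (@voaL_linear R V 0) dL (undup_uniq _) dt).
by rewrite mem_undup inE negb_or => /andP[/negPf-> /r0->]; rewrite subrr.
Qed.

Lemma Yopp_vac p w : Yopp (vac V) p w = if p == 0 then w else 0.
Proof.
have L1 : voaL 1 (vac V) = 0 by rewrite [LHS]Yvoa_creation.
rewrite /Yopp (@fsum_only _ _ (0, 0%N)) => [|[n m] nm].
  rewrite /= wt_comp_vac eqxx fact0 divr1 scale1r Ytm_vac.
  by rewrite mulr0 subr0 sub0r oppr_eq0.
rewrite /= wt_comp_vac; case: eqP => [n0|_]; last first.
  by rewrite iter_voaL1_zero// Ytm0l scaler0.
case: m nm => [|m] nm; first by case: nm; rewrite n0.
by rewrite iterSr L1 iter_voaL1_zero// Ytm0l scaler0.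
Qed.

End OppositeOperators.

(** * The action on the tensor product *)

Section FiniteOrder.
Variables (R : realType) (T : nat).
Hypothesis T_gt0 : (0 < T)%N.

(** Equality with 1 would give cos 2x = 1, hence sin x = 0, for x = pi m / T, whereas 0 < x < pi. *)
Lemma epi2_root m : (0 < m < T)%N -> epi R (2 * qfrac T m%:Z) != 1.
Proof.
case/andP=> m0 mT; apply/eqP => /(congr1 (@complex.Re R)).
rewrite /epi /cexp /= expR0 mul1r => cos1.
pose x : R := m%:R / T%:R * pi.
have xE : ratr (2 * qfrac T m%:Z) * pi = x + x.
  rewrite /x /qfrac !rmorphM fmorphV !rmorph_nat /=.
  by ring.
have : 0 < sin x.
  apply: sin_gt0_pi; rewrite mulr_gt0 ?pi_gt0 ?divr_gt0 ?ltr0n//=.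
  by rewrite gtr_pMl ?pi_gt0// ltr_pdivrMr ?ltr0n// mul1r ltr_nat.
move: cos1; rewrite xE cosD -!expr2 => cos1.
have := cos2Dsin2 x; rewrite -cos1 => /eqP; rewrite -subr_eq0.
rewrite opprD opprK addrACA subrr add0r -mulr2n mulrn_eq0 /= sqrf_eq0.
by move=> /eqP ->; rewrite ltxx.
Qed.

Lemma epi2_period (n : int) : epi R (2 * qfrac T (T%:Z * n)) = 1.
Proof.
have -> : 2 * qfrac T (T%:Z * n) = (2 * n)%:~R.
  rewrite /qfrac !rmorphM /= -[T%:Z%:~R]/(T%:R); field.
  by rewrite pnatr_eq0 -lt0n.
by rewrite epi_int -exprz_exp -[(-1) ^ 2%:Z]/((-1) ^+ 2) sqrrN expr1n exp1rz.
Qed.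

Lemma epi2D (m n : int) : epi R (2 * qfrac T (m + n)) =
  epi R (2 * qfrac T m) * epi R (2 * qfrac T n).
Proof. by rewrite qfracD mulrDr epiD. Qed.

Lemma epi2_sum m : (m < T)%N ->
  \sum_(j < T) epi R (2 * qfrac T (- (j%:Z * m%:Z))) = if m == 0%N then T%:R else 0.
Proof.
move=> mT; pose x := epi R (2 * qfrac T (- m%:Z)).
have xE (j : nat) : epi R (2 * qfrac T (- (j%:Z * m%:Z))) = x ^+ j.
  elim: j => [|j ih]; first by rewrite mul0r oppr0 /qfrac mul0r mulr0 epi0.
  rewrite exprS -ih -epi2D; congr (epi R (2 * qfrac T _)).
  by rewrite -addn1 PoszD; ring.
under eq_bigr => j _ do rewrite xE.
case: eqP => [m0|/eqP m0].
  rewrite (eq_bigr (fun=> 1)) => [|j _]; first by rewrite sumr_const card_ord.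
  by rewrite /x m0 oppr0 /qfrac mul0r mulr0 epi0 expr1n.
have x1 : x != 1.
  rewrite /x qfracN mulrN epiN invr_eq1; apply: epi2_root.
  by rewrite lt0n m0.
have x10 : x - 1 != 0 by rewrite subr_eq0.
by apply: (mulfI x10); rewrite -subrX1 mulr0 -xE -mulrN epi2_period subrr.
Qed.

(** Discrete Fourier inversion on the orbit of v: c_j averages e^(-2 pi i j m / T) s^m v over m.
    Orthogonality of the characters recovers v, and shifting m cyclically gives the eigenvalue. *)
Lemma finite_order_eigen (V : voa R) (s : V -> V) (v : V) : linear s ->
  iter T s v = v ->
  exists c : nat -> V, v = \sum_(j < T) c j /\ forall j, eigen T s j%:Z (c j).
Proof.
move=> slin sT; have T0 : (T%:R : R[i]) != 0 by rewrite pnatr_eq0 -lt0n.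
pose G (j m : nat) := epi R (2 * qfrac T (- (j%:Z * m%:Z))) *: iter m s v.
exists (fun j => T%:R^-1 *: \sum_(m < T) G j m); split=> [|j].
  rewrite -scaler_sumr exchange_big /=; apply: (scalerI T0); rewrite scalerKV//.
  rewrite (eq_bigr (fun m : 'I_T => (if m == 0%N :> nat then T%:R else 0) *: iter m s v)).
    by case: T T_gt0 => // n _; rewrite big_ord_recl /= big1 ?addr0// => i _; rewrite scale0r.
  by move=> m _; rewrite -scaler_suml epi2_sum.
rewrite /eigen (linear_funZ slin) (linear_fun_sum slin) !scalerA mulrC -scalerA.
congr (_ *: _); rewrite scaler_sumr.
transitivity (\sum_(m < T) epi R (2 * qfrac T j%:Z) *: G j m.+1).
  apply: eq_bigr => m _; rewrite (linear_funZ slin) scalerA -epi2D -iterS.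
  congr (epi R (2 * qfrac T _) *: _); rewrite -addn1 PoszD; ring.
have GT : G j T = G j 0%N.
  by rewrite /G sT mulr0 oppr0 (mulrC j%:Z) -mulrN epi2_period /qfrac mul0r mulr0 epi0.
rewrite -!scaler_sumr; congr (_ *: _).
case: T GT => [|n] GT; first by rewrite !big_ord0.
by rewrite big_ord_recr big_ord_recl /= GT addrC.
Qed.

End FiniteOrder.

Lemma bounded_below_sum (M : zmodType) (I : Type) (r : seq I) (f : I -> rat -> M) :
  (forall i, bounded_below (f i)) -> bounded_below (fun p => \sum_(i <- r) f i p).
Proof.
move=> fb; elim: r => [|i r [N hN]]; first by exists 0 => p _; rewrite big_nil.
have [N' hN'] := fb i; exists (Num.min N N') => p; rewrite lt_min => /andP[h1 h2].
by rewrite big_cons hN// hN' ?addr0.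
Qed.

Section BoundedModules.
Variables (R : realType) (V : voa R) (T : nat) (s : V -> V).
Hypotheses (T_gt0 : (0 < T)%N) (s_aut : voa_aut s) (sT : forall v, iter T s v = v).

(** [Ytm_laurent] speaks of eigenvectors only, while [Ytensor] involves arbitrary vectors; these are
    finite sums of eigenvectors. *)
Lemma Ytm_bounded (W : twisted_module T s) v (w : W) :
  bounded_below (fun p => Ytm v p w).
Proof.
have [c [vE cE]] := finite_order_eigen T_gt0 (aut_linear s_aut) (sT v).
have [N hN] : bounded_below (fun p => \sum_(j < T) Ytm (c j) p w).
  by apply: bounded_below_sum => j; have [] := Ytm_eigen w (cE j).
exists N => p pN; rewrite vE (linear_fun_sum (@Ytm_linear_l _ _ _ _ W p w)).
exact: hN.
Qed.

End BoundedModules.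

(** Exponents of twisted operators lie in (1/T) Z, so only finitely many fall between two truncation
    bounds. *)
Lemma grid_finite (T : nat) (a b : rat) : (0 < T)%N ->
  exists r : seq rat, forall q, q * T%:R \is a Num.int -> a <= q -> q <= b -> q \in r.
Proof.
move=> T0; have T0' : (T%:R : rat) != 0 by rewrite pnatr_eq0 -lt0n.
have [M1 h1] := nat_bound (- (a * T%:R)); have [M2 h2] := nat_bound (b * T%:R).
pose M := maxn M1 M2.
exists [seq (n%:R - M%:R) / T%:R | n <- iota 0 (M + M).+1] => q /intrP [k kE] aq qb.
have TP : 0 < T%:R :> rat by rewrite ltr0n.
have k1 : (- M%:Z) <= k.
  rewrite -(ler_int rat) -kE mulrNz -[M%:Z%:~R]/(M%:R) lerNl; apply: ltW.
  apply: (le_lt_trans _ (h1 M (leq_maxl _ _))).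
  by rewrite lerN2 ler_pM2r.
have k2 : k <= M%:Z.
  rewrite -(ler_int rat) -kE; apply: ltW.
  by apply: (le_lt_trans _ (h2 M (leq_maxr _ _))); rewrite ler_pM2r.
have kM : 0 <= k + M%:Z by rewrite -lerBlDr sub0r.
apply/mapP; exists (absz (k + M%:Z)).
  by rewrite mem_iota add0n ltnS /= -lez_nat gez0_abs// PoszD lerD2r.
apply: (mulIf T0'); rewrite divfK// kE.
by rewrite [X in X - _]pmulrn gez0_abs// rmorphD /= addrK.
Qed.

Definition finitely_supported (M : zmodType) (I : eqType) (F : I -> M) : Prop :=
  exists r : seq I, forall i, i \notin r -> F i = 0.

Section FinitelySupported.
Variables (K : pzRingType) (U X : lmodType K) (I : choiceType).
Implicit Types F G : I -> U.

Lemma fsum_linear a F G : finitely_supported F -> finitely_supported G ->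
  \sum_(i \in [set: I]) (a *: F i + G i) =
  a *: \sum_(i \in [set: I]) F i + \sum_(i \in [set: I]) G i.
Proof.
move=> [r r0] [t t0]; pose m := undup (r ++ t).
have F0 i : i \notin m -> F i = 0.
  by rewrite mem_undup mem_cat negb_or => /andP[/r0].
have G0 i : i \notin m -> G i = 0.
  by rewrite mem_undup mem_cat negb_or => /andP[_ /t0].
rewrite !(@fsum_seq _ _ m) ?undup_uniq// => [|i im].
  by rewrite big_split scaler_sumr.
by rewrite F0// G0// scaler0 addr0.
Qed.

Lemma linear_fun_fsum (f : U -> X) F : linear f -> finitely_supported F ->
  f (\sum_(i \in [set: I]) F i) = \sum_(i \in [set: I]) f (F i).
Proof.
move=> flin [r r0]; pose m := undup r.
have F0 i : i \notin m -> F i = 0 by rewrite mem_undup; exact: r0.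
rewrite !(@fsum_seq _ _ m) ?undup_uniq// => [|i im]; first exact: linear_fun_sum.
by rewrite F0// (linear_fun0 flin).
Qed.

End FinitelySupported.

Section TensorAction.
Variables (R : realType) (V : voa R) (T : nat) (s1 s2 : V -> V).
Hypotheses (T_gt0 : (0 < T)%N) (aut1 : voa_aut s1) (aut2 : voa_aut s2).
Hypotheses (s1T : forall v, iter T s1 v = v) (s2T : forall v, iter T s2 v = v).
Variables (W1 : twisted_module T s1) (W2 : twisted_module T s2).
Implicit Types u v : V.

Lemma tpure0l (w2 : W2) : tpure (0 : W1) w2 = 0.
Proof. by have [] := bilinear_map_scale (@tpure_bilinear _ W1 W2). Qed.

Lemma tpure0r (w1 : W1) : tpure w1 (0 : W2) = 0.
Proof. by have [] := bilinear_map_scale (@tpure_bilinear _ W1 W2). Qed.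

Lemma tpure_linearl (w2 : W2) : linear ((@tpure _ W1 W2)^~ w2).
Proof. by have [h _] := @tpure_bilinear _ W1 W2; exact: h. Qed.

Lemma tpure_linearr (w1 : W1) : linear (@tpure _ W1 W2 w1).
Proof. by have [_ h] := @tpure_bilinear _ W1 W2; exact: h. Qed.

Lemma Ytm_pair_finite u v p (w1 : W1) (w2 : W2) :
  finitely_supported (fun q => tpure (Ytm u q w1) (Ytm v (p - q) w2)).
Proof.
have [N1 h1] := Ytm_bounded T_gt0 aut1 s1T u w1.
have [N2 h2] := Ytm_bounded T_gt0 aut2 s2T v w2.
have [r hr] := grid_finite N1 (p - N2) T_gt0; exists r => q qr.
have [qi|qi] := boolP (q * T%:R \is a Num.int); last by rewrite Ytm_support// tpure0l.
have [qN|qN] := ltP q N1; first by rewrite h1// tpure0l.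
have [qp|qp] := ltP (p - q) N2; first by rewrite h2// tpure0r.
by move: qr; rewrite hr// lerBrDr -lerBrDl.
Qed.

Definition Ypair u v p (w1 : W1) (w2 : W2) : tensor W1 W2 :=
  \sum_(q \in [set: rat]) tpure (Ytm u q w1) (Ytm v (p - q) w2).

Lemma Ypair_bilinear u v p : bilinear_map (Ypair u v p).
Proof.
split=> [w2|w1] a x y; rewrite /Ypair -fsum_linear; try exact: Ytm_pair_finite.
  by apply: eq_fsbigr => q _; rewrite Ytm_linear_r tpure_linearl.
by apply: eq_fsbigr => q _; rewrite Ytm_linear_r tpure_linearr.
Qed.

Lemma Ypair_linear_l v p (w1 : W1) (w2 : W2) : linear (fun u => Ypair u v p w1 w2).
Proof.
move=> a x y; rewrite /Ypair -fsum_linear; try exact: Ytm_pair_finite.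
by apply: eq_fsbigr => q _; rewrite Ytm_linear_l tpure_linearl.
Qed.

Lemma Ypair_linear_r u p (w1 : W1) (w2 : W2) : linear (fun v => Ypair u v p w1 w2).
Proof.
move=> a x y; rewrite /Ypair -fsum_linear; try exact: Ytm_pair_finite.
by apply: eq_fsbigr => q _; rewrite Ytm_linear_l tpure_linearr.
Qed.

Lemma Ytensor_bilinear p (t : tensor W1 W2) :
  bilinear_map (fun u v : V => tlift (Ypair u v p) t).
Proof.
split=> [v|u] a x y; rewrite /tlift scaler_sumr -big_split; apply: eq_bigr => e _.
  exact: Ypair_linear_l.
exact: Ypair_linear_r.
Qed.

Lemma YtensorD a b p (t : tensor W1 W2) :
  Ytensor (a + b) p t = Ytensor a p t + Ytensor b p t.
Proof. exact: linear_funD (tlift_linear (Ytensor_bilinear p t)) a b. Qed.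

Lemma Ytensor0 p (t : tensor W1 W2) : Ytensor 0 p t = 0.
Proof. exact: linear_fun0 (tlift_linear (Ytensor_bilinear p t)). Qed.

Lemma Ytensor_pure u v p (t : tensor W1 W2) :
  Ytensor (tpure u v) p t = \sum_(e <- repr t) Ypair u v p e.1 e.2.
Proof. exact: tliftE (Ytensor_bilinear p t). Qed.

Lemma Ytensor_pure_pure u v p (w1 : W1) (w2 : W2) :
  Ytensor (tpure u v) p (tpure w1 w2) = Ypair u v p w1 w2.
Proof.
rewrite [LHS](tliftE _ _ (Ytensor_bilinear p _)).
exact: tliftE (Ypair_bilinear u v p).
Qed.

End TensorAction.

(** * The operators Y^R and Y^L *)

Section SeriesOfFunctions.
Variables (R : realType) (z : R[i]).
Local Notation K := (R[i]).
Implicit Types (f g : rat -> K) (a b p r : rat) (c s e : K).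

Lemma mulcxZ a s e g p : mulcx z a s (fun q => e * g q) p = e * mulcx z a s g p.
Proof. by rewrite /mulcx mulr_fsumr; apply: eq_fsbigr => i _; ring. Qed.

Lemma eq_mulcx a s g g' p : g =1 g' -> mulcx z a s g p = mulcx z a s g' p.
Proof. by move=> gg; apply: eq_fsbigr => i _; rewrite gg. Qed.

Lemma bounded_below_app (X : Type) (Y : zmodType) (G : rat -> X -> Y) x :
  bounded_below (G : rat -> (X -> Y)) -> bounded_below (G^~ x).
Proof. by move=> [N hN]; exists N => p /hN ->. Qed.

Lemma iter_deriv (U : lmodType K) (f : rat -> U) i p :
  iter i (@deriv_series R U) f p =
  (ratr (\prod_(m < i) (p + i%:R - m%:R)) : K) *: f (p + i%:R).
Proof.
elim: i p => [|i ih] p; first by rewrite big_ord0 rmorph1 scale1r addr0.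
rewrite iterS {1}/deriv_series ih scalerA -rmorphM /=.
have -> : p + 1 + i%:R = p + i.+1%:R by rewrite -natr1; ring.
congr (ratr _ *: _); rewrite big_ord_recr /= mulrC; congr (_ * _).
by rewrite -natr1; ring.
Qed.

End SeriesOfFunctions.

Section RegularOperators.
Variables (R : realType) (V : voa R) (T : nat) (s1 s2 s : V -> V) (z : R[i]).
Hypotheses (aut1 : voa_aut s1) (aut2 : voa_aut s2) (Ks : cancel (s1 \o s2) s).
Hypothesis z_neq0 : z != 0.
Variable W : twisted_module T s.
Variables (j1 j2 : int) (v : V) (al : W -> R[i]^o).
Hypotheses (v_eigen : eigen2 T s1 s2 j1 j2 v) (al0 : al 0 = 0).
Local Notation K := (R[i]).
Local Notation q1 := (qfrac T j1).
Local Notation q2 := (qfrac T j2).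
Implicit Types (k l : nat) (p r : rat) (G H : rat -> W -> R[i]^o).

Lemma Ystar_coset w p : p + (q1 + q2) \isn't a Num.int -> Ystar v al p w = 0.
Proof. by move=> pi; rewrite /Ystar (Yopp_coset aut1 aut2 Ks w v_eigen). Qed.

Lemma Ystar_bounded w : bounded_above ((Ystar v al)^~ w).
Proof.
have [N hN] := Yopp_bounded aut1 aut2 Ks w v_eigen.
by exists N => p /hN h; rewrite /Ystar h.
Qed.

Lemma clearedRE k p w :
  clearedR z j1 k v al p w = mulxc (k%:R + q1) (- z) ((Ystar v al)^~ w) p.
Proof. exact: sum_pow_xc. Qed.

(** Expresses the translated series by powers of x - z acting on [Ystar] itself, exponent and
    position being exchanged, so that it can be compared with the P(z)-identity. *)
Lemma clearedLE l p w : clearedL z j2 l v al p w =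
  mulxc (- 1 - p) (- z) ((Ystar v al)^~ w) (- 1 - (l%:R + q2)).
Proof.
rewrite -(translate_mulxc z (l%:R + q2) p (Ystar_bounded w)).
rewrite -[LHS]/(\sum_(q \in [set: rat])
  pow_xc (l%:R + q2) z q * translate z (Ystar v al) (p - q) w).
rewrite (sum_pow_xc _ _ (fun q => translate z (Ystar v al) q w)).
apply: eq_fsbigr => j _; congr (_ * _); apply: eq_fsbigr => i _.
rewrite iter_deriv /gbinom fmorph_div rmorph_nat /=.
by rewrite -[(_ *: _) w]/(_ * _) ; ring.
Qed.

Lemma mulxc_Ystar_rec w b r :
  mulxc (b + 1) (- z) ((Ystar v al)^~ w) r =
  mulxc b (- z) ((Ystar v al)^~ w) (r - 1) - z * mulxc b (- z) ((Ystar v al)^~ w) r.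
Proof. by rewrite (mulxc_rec _ _ _ (Ystar_bounded w)) mulNr. Qed.

(* defectR vanishes when (x - z)^b Y*(v,x) alpha = e^(b pi i) (z - x)^b G(x), and
   defectL when (x + z)^b Y*(v,x+z) alpha = (z + x)^b H(x); in the latter the left
   side is rewritten as a coefficient of a power of x - z times Y*(v,x) alpha. *)
Definition defectR G w b r : K := mulxc b (- z) ((Ystar v al)^~ w) r -
  epi R b * mulcx z b (-1) (G^~ w) r.

Definition defectL H w b r : K :=
  mulxc (- 1 - r) (- z) ((Ystar v al)^~ w) (- 1 - b) - mulcx z b 1 (H^~ w) r.

(** As e^((b+1) pi i) = - e^(b pi i), the product e^(b pi i) (z - x)^b obeys the recurrence of (x -
    z)^b. *)
Lemma defectR_rec G w : bounded_below (G^~ w) -> forall b r,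
  defectR G w (b + 1) r = defectR G w b (r - 1) + - z * defectR G w b r.
Proof.
move=> Gb b r; rewrite /defectR mulxc_Ystar_rec (mulcx_rec z_neq0 _ _ _ Gb).
by rewrite epiD epi1; ring.
Qed.

(** In the first term b is a position and r an exponent; solving the recurrence of [mulxc] for its
    lower position turns - z into z. *)
Lemma defectL_rec H w : bounded_below (H^~ w) -> forall b r,
  defectL H w (b + 1) r = defectL H w b (r - 1) + z * defectL H w b r.
Proof.
move=> Hb b r; rewrite /defectL (mulcx_rec z_neq0 _ _ _ Hb).
have -> : - 1 - (r - 1) = - 1 - r + 1 by ring.
by rewrite mulxc_Ystar_rec [- 1 - (b + 1)](_ : _ = - 1 - b - 1); ring.
Qed.

(** Characterizes Y^R(v,x) alpha independently of the exponent picked by [xget]; see [YR_match] and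
    [YR_matches]. The support and the bound are uniform in w, as for Laurent series with
    coefficients in the dual. *)
Definition matchR G : Prop :=
  [/\ forall p, p + q2 \isn't a Num.int -> G p = 0, bounded_below G &
      exists k0, forall k, (k0 <= k)%N ->
        forall w p, defectR G w (k%:R + q1) p = 0].

Definition matchL H : Prop :=
  [/\ forall p, p + q1 \isn't a Num.int -> H p = 0, bounded_below H &
      exists l0, forall l, (l0 <= l)%N ->
        forall w p, defectL H w (l%:R + q2) p = 0].

Lemma matchR_good G : matchR G -> exists k, goodR z j1 j2 v al k.
Proof.
move=> [Gs [N hN] [k hk]]; exists k; apply/laurent_xshiftE.
have E p w : clearedR z j1 k v al p w =
    epi R (k%:R + q1) * mulcx z (k%:R + q1) (-1) (G^~ w) p.
  by rewrite clearedRE; apply/eqP; rewrite -subr_eq0; apply/eqP; exact: hk.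
split=> [p pi|]; last exists N => p pN; apply/funext => w; rewrite E.
  by rewrite (mulcx_coset _ _ _ _ pi) ?mulr0// => q /Gs->.
by rewrite (mulcx_bounded _ _ _ _ pN) ?mulr0// => q /hN->.
Qed.

Lemma matchL_good H : matchL H -> exists l, goodL z j1 j2 v al l.
Proof.
move=> [Hs [N hN] [l hl]]; exists l; apply/laurent_xshiftE.
have E p w : clearedL z j2 l v al p w = mulcx z (l%:R + q2) 1 (H^~ w) p.
  by rewrite clearedLE; apply/eqP; rewrite -subr_eq0; apply/eqP; exact: hl.
split=> [p pi|]; last exists N => p pN; apply/funext => w; rewrite E.
  by rewrite (mulcx_coset _ _ _ _ pi)// => q /Hs->.
by rewrite (mulcx_bounded _ _ _ _ pN)// => q /hN->.
Qed.

Lemma bounded_belowB (f g : rat -> K) : bounded_below f -> bounded_below g ->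
  bounded_below (fun p => f p - g p).
Proof.
move=> [N hN] [N' hN']; exists (Num.min N N') => p; rewrite lt_min => /andP[h1 h2].
by rewrite hN// hN'// subrr.
Qed.

Lemma mulcx_bounded_below b c (g : rat -> K) e : bounded_below g ->
  bounded_below (fun p => e * mulcx z b c g p).
Proof.
by move=> [N hN]; exists N => p pN; rewrite (mulcx_bounded _ _ _ hN pN) mulr0.
Qed.

Lemma YR_match G p : matchR G -> YR z j1 j2 v p al = G p.
Proof.
move=> hG; have := xgetPex 0%N (matchR_good hG); rewrite /YR.
set k := xget _ _ => /laurent_xshiftE [_ cb]; have [Gs Gb [k0 hk0]] := hG.
apply/funext => w; have Gwb := bounded_below_app w Gb.
(* The chosen k may lie below k0. The relation holds at k + k0, and [rec_regress] brings it down to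
   k, where admissibility bounds the series below. *)
have D0 : forall r, defectR G w (k%:R + q1) r = 0.
  apply: (rec_regress (c := - z) _ (defectR_rec Gwb) (d := k0)).
  - by rewrite oppr_eq0.
  - apply: bounded_belowB; last exact: mulcx_bounded_below.
    have [N hN] := cb; exists N => r /hN /(congr1 (@^~ w)).
    by rewrite clearedRE.
  - by move=> r; rewrite addrAC -natrD; apply: hk0; rewrite leq_addl.
set b := k%:R + q1 in D0 *.
have E r : clearedR z j1 k v al r w = epi R b * mulcx z b (-1) (G^~ w) r.
  by rewrite clearedRE; apply/eqP; rewrite -subr_eq0; apply/eqP; exact: D0.
rewrite -[LHS]/(epi R (- b) * \sum_(q \in [set: rat])
   pow_cx z (- b) (-1) q * clearedR z j1 k v al (p - q) w).
rewrite (sum_pow_cx _ _ _ (fun q => clearedR z j1 k v al q w)) (eq_mulcx _ _ _ _ E).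
by rewrite mulcxZ mulcxK// mulrA -epiD addNr epi0 mul1r.
Qed.

Lemma YL_match H p : matchL H -> YL z j1 j2 v p al = H p.
Proof.
move=> hH; have := xgetPex 0%N (matchL_good hH); rewrite /YL.
set l := xget _ _ => /laurent_xshiftE [_ cb]; have [Hs Hb [l0 hl0]] := hH.
apply/funext => w; have Hwb := bounded_below_app w Hb.
have D0 : forall r, defectL H w (l%:R + q2) r = 0.
  apply: (rec_regress z_neq0 (defectL_rec Hwb) (d := l0)).
  - apply: bounded_belowB.
      have [N hN] := cb; exists N => r /hN /(congr1 (@^~ w)).
      by rewrite clearedLE.
    by have [N hN] := Hwb; exists N; exact: mulcx_bounded.
  - by move=> r; rewrite addrAC -natrD; apply: hl0; rewrite leq_addl.
set b := l%:R + q2 in D0 *.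
have E r : clearedL z j2 l v al r w = mulcx z b 1 (H^~ w) r.
  by rewrite clearedLE; apply/eqP; rewrite -subr_eq0; apply/eqP; exact: D0.
rewrite -[LHS]/(\sum_(q \in [set: rat])
   pow_cx z (- b) 1 q * clearedL z j2 l v al (p - q) w).
rewrite (sum_pow_cx _ _ _ (fun q => clearedL z j2 l v al q w)) (eq_mulcx _ _ _ _ E).
exact: mulcxK.
Qed.

Lemma YR_matches : (exists k, goodR z j1 j2 v al k) ->
  matchR (fun p => YR z j1 j2 v p al).
Proof.
move=> /(xgetPex 0%N); rewrite /matchR /YR; set k := xget _ _.
move=> /laurent_xshiftE [cs cb]; set b := k%:R + q1.
pose C := clearedR z j1 k v al.
have YE p w : (epi R (- b) *: conv (pow_cx z (- b) (-1)) C p : W -> R[i]^o) w =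
    epi R (- b) * mulcx z (- b) (-1) (C^~ w) p.
  by congr (_ * _); exact: sum_pow_cx.
have Yb : bounded_below
    (fun p => epi R (- b) *: conv (pow_cx z (- b) (-1)) C p : W -> R[i]^o).
  have [N hN] := cb; exists N => p pN; apply/funext => w; rewrite YE.
  by rewrite (mulcx_bounded _ _ _ _ pN) ?mulr0// => q /hN; rewrite /C => ->.
split=> // [p pi|].
  apply/funext => w; rewrite YE (mulcx_coset _ _ _ _ pi) ?mulr0// => q /cs.
  by rewrite /C => ->.
exists k => k' kk' w p; rewrite -(subnK kk') natrD -addrA addrC.
apply: (rec_zero (defectR_rec (bounded_below_app w Yb))) => r.
rewrite /defectR -clearedRE (eq_mulcx _ _ _ _ (fun q => YE q w)) mulcxZ mulrA -epiD subrr.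
rewrite epi0 mul1r -[k%:R + q1]opprK mulcxK ?subrr//.
exact: bounded_below_app.
Qed.

Lemma YL_matches : (exists l, goodL z j1 j2 v al l) ->
  matchL (fun p => YL z j1 j2 v p al).
Proof.
move=> /(xgetPex 0%N); rewrite /matchL /YL; set l := xget _ _.
move=> /laurent_xshiftE [cs cb]; set b := l%:R + q2.
pose C := clearedL z j2 l v al.
have YE p w : (conv (pow_cx z (- b) 1) C p : W -> R[i]^o) w =
    mulcx z (- b) 1 (C^~ w) p by exact: sum_pow_cx.
have Yb : bounded_below (fun p => conv (pow_cx z (- b) 1) C p : W -> R[i]^o).
  have [N hN] := cb; exists N => p pN; apply/funext => w; rewrite YE.
  by rewrite (mulcx_bounded _ _ _ _ pN)// => q /hN; rewrite /C => ->.
split=> // [p pi|].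
  apply/funext => w; rewrite YE (mulcx_coset _ _ _ _ pi)// => q /cs.
  by rewrite /C => ->.
exists l => l' ll' w p; rewrite -(subnK ll') natrD -addrA addrC.
apply: (rec_zero (defectL_rec (bounded_below_app w Yb))) => r.
rewrite /defectL -clearedLE (eq_mulcx _ _ _ _ (fun q => YE q w)).
rewrite -[l%:R + q2]opprK mulcxK ?subrr//.
exact: bounded_below_app.
Qed.

(** The coefficient of x^p in the left-cleared series is that of x^(-1-l-q2) in (x - z)^(-1-p)
    applied to [Ystar]. For p < -1-k-q1 the latter is a natural power of x - z times the
    right-cleared series, which is bounded below by N uniformly in w; l is chosen with -1-l-q2 <
    N. *)
Lemma goodR_goodL : (exists k, goodR z j1 j2 v al k) ->
  exists l, goodL z j1 j2 v al l.
Proof.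
move=> [k /laurent_xshiftE [_ [N hN]]].
have [l hl] := nat_bound (- 1 - q2 - N); exists l; apply/laurent_xshiftE.
have cs p : p + q1 \isn't a Num.int -> clearedL z j2 l v al p = 0.
  move=> pi; apply/funext => w; rewrite clearedLE.
  apply: (mulxc_coset _ (fun q => @Ystar_coset w q)); apply: contra pi => pi.
  have -> : p + q1 = (- 1 - (l%:R + q2) - (- 1 - p) + (q1 + q2)) + l%:R by ring.
  by rewrite rpredD// natr_int.
split=> //; exists (- 1 - (k%:R + q1)) => p pB.
have [/intrP[m pm]|/cs//] := boolP (p + q1 \is a Num.int).
apply/funext => w; rewrite clearedLE.
have m_le : m + 1 + k%:Z <= 0.
  rewrite -(ler_int rat) !rmorphD /= -pm -[k%:Z%:~R]/(k%:R).
  have -> : p + q1 + 1 + k%:R = p - (- 1 - (k%:R + q1)) by ring.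
  by rewrite subr_le0 ltW.
have -> : - 1 - p = (k%:R + q1) + (absz (m + 1 + k%:Z))%:R.
  rewrite [(absz _)%:R]pmulrn abszE ler0_norm// mulrNz !rmorphD /= -pm.
  by rewrite -[k%:Z%:~R]/(k%:R); ring.
apply: (rec_bounded (c := - z) (E := fun b r => mulxc b (- z) ((Ystar v al)^~ w) r) _ _ (N := N)).
- by move=> b r; rewrite mulxc_Ystar_rec mulNr.
- by move=> r /hN /(congr1 (@^~ w)); rewrite clearedRE.
- rewrite -subr_gt0; have -> : N - (- 1 - (l%:R + q2)) = l%:R - (- 1 - q2 - N) by ring.
  by rewrite subr_gt0 hl.
Qed.

End RegularOperators.

Lemma dual_linear (K : fieldType) (U : lmodType K) (al : dual U) : linear al.
Proof. by case: al => f /= /asboolP. Qed.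

Lemma dual_fun_linear (K : fieldType) (U : lmodType K) :
  linear (@dual_fun K U : dual U -> (U -> K^o)).
Proof. by move=> a al be; exact: (linearP (val : dual U -> (U -> K^o))). Qed.

Lemma fsum_exchange (K : pzRingType) (U : lmodType K) (I : choiceType) (J : Type)
    (r : seq J) (F : J -> I -> U) : (forall j, finitely_supported (F j)) ->
  finitely_supported (fun i => \sum_(j <- r) F j i) /\
  \sum_(j <- r) \sum_(i \in [set: I]) F j i =
  \sum_(i \in [set: I]) \sum_(j <- r) F j i.
Proof.
move=> Ff; elim: r => [|j r [[t ht] ih]].
  split; first by exists [::] => i _; rewrite big_nil.
  by rewrite big_nil fsbig1// => i _; rewrite big_nil.
split.
  have [t' ht'] := Ff j; exists (t' ++ t) => i.
  by rewrite mem_cat negb_or big_cons => /andP[/ht'-> /ht->]; rewrite addr0.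
rewrite big_cons ih -[X in X + _]scale1r -fsum_linear//; last by exists t.
by apply: eq_fsbigr => i _; rewrite big_cons scale1r.
Qed.

(** * Additivity of the defining relations, and the vacuum *)

Section MatchProperties.
Variables (R : realType) (V : voa R) (T : nat) (s1 s2 s : V -> V) (z : R[i]).
Hypotheses (aut1 : voa_aut s1) (aut2 : voa_aut s2) (Ks : cancel (s1 \o s2) s).
Hypothesis z_neq0 : z != 0.
Variable W : twisted_module T s.
Local Notation K := (R[i]).
Implicit Types (al be : W -> K^o) (G H : rat -> W -> K^o) (v : V).

Lemma mulxcD a c (f g : rat -> K) p : bounded_above f -> bounded_above g ->
  mulxc a c (fun q => f q + g q) p = mulxc a c f p + mulxc a c g p.
Proof.
move=> fb gb; rewrite /mulxc -fsum_split; try exact/fin_mulr/bounded_above_nat.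
by apply: eq_fsbigr => i _; rewrite mulrDr.
Qed.

Lemma mulcxD a c (f g : rat -> K) p : bounded_below f -> bounded_below g ->
  mulcx z a c (fun q => f q + g q) p = mulcx z a c f p + mulcx z a c g p.
Proof.
move=> fb gb; rewrite /mulcx -fsum_split; try exact/fin_mulr/bounded_below_nat.
by apply: eq_fsbigr => i _; rewrite mulrDr.
Qed.

Lemma mulxc_0 a c p : mulxc a c (fun=> 0 : K) p = 0.
Proof. by rewrite /mulxc fsbig1// => i _; rewrite mulr0. Qed.

Lemma mulcx_0 a c p : mulcx z a c (fun=> 0 : K) p = 0.
Proof. by rewrite /mulcx fsbig1// => i _; rewrite mulr0. Qed.

Lemma mulxc0 c (f : rat -> K) p : mulxc 0 c f p = f p.
Proof.
rewrite /mulxc (@fsum_only _ _ 0%N) => [|i /eqP/negPf i0].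
  by rewrite gbinom0 expr0 !mul1r subr0 addr0.
by rewrite gbinom_0n i0 !mul0r.
Qed.

Lemma mulcx0 c (f : rat -> K) p : mulcx z 0 c f p = f p.
Proof.
rewrite /mulcx (@fsum_only _ _ 0%N) => [|i /eqP/negPf i0].
  by rewrite gbinom0 expr0 subr0 cpow0 !mul1r subr0.
by rewrite gbinom_0n i0 !mul0r.
Qed.

Lemma bounded_belowD (M : zmodType) (f g : rat -> M) :
  bounded_below f -> bounded_below g -> bounded_below (fun p => f p + g p).
Proof.
move=> [N hN] [N' hN']; exists (Num.min N N') => p; rewrite lt_min => /andP[h1 h2].
by rewrite hN// hN'// addr0.
Qed.

Lemma matchR0 j1 j2 v : matchR z j1 j2 v (0 : W -> K^o) 0.
Proof.
split=> //; first by exists 0.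
by exists 0%N => k _ w p; rewrite /defectR mulxc_0 mulcx_0 mulr0 subrr.
Qed.

Lemma matchL0 j1 j2 v : matchL z j1 j2 v (0 : W -> K^o) 0.
Proof.
split=> //; first by exists 0.
by exists 0%N => k _ w p; rewrite /defectL mulxc_0 mulcx_0 subrr.
Qed.

Lemma matchRD j1 j2 v al be G H : eigen2 T s1 s2 j1 j2 v -> al 0 = 0 -> be 0 = 0 ->
  matchR z j1 j2 v al G -> matchR z j1 j2 v be H ->
  matchR z j1 j2 v (al + be) (fun p => G p + H p).
Proof.
move=> hv al0 be0 [Gs Gb [k hk]] [Hs Hb [l hl]]; split.
- by move=> p pi; rewrite Gs// Hs// addr0.
- exact: bounded_belowD.
exists (maxn k l) => m; rewrite geq_max => /andP[/hk h1 /hl h2] w p.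
have e1 := mulxcD (m%:R + qfrac T j1) (- z) p
  (Ystar_bounded aut1 aut2 Ks hv al0 w) (Ystar_bounded aut1 aut2 Ks hv be0 w).
have e2 := mulcxD (m%:R + qfrac T j1) (- 1) p
  (bounded_below_app w Gb) (bounded_below_app w Hb).
apply: etrans (congr2 (fun a b => a - epi R (m%:R + qfrac T j1) * b) e1 e2) _.
rewrite mulrDr opprD addrACA.
by apply: etrans (congr2 +%R (h1 w p) (h2 w p)) _; rewrite addr0.
Qed.

Lemma matchLD j1 j2 v al be G H : eigen2 T s1 s2 j1 j2 v -> al 0 = 0 -> be 0 = 0 ->
  matchL z j1 j2 v al G -> matchL z j1 j2 v be H ->
  matchL z j1 j2 v (al + be) (fun p => G p + H p).
Proof.
move=> hv al0 be0 [Gs Gb [k hk]] [Hs Hb [l hl]]; split.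
- by move=> p pi; rewrite Gs// Hs// addr0.
- exact: bounded_belowD.
exists (maxn k l) => m; rewrite geq_max => /andP[/hk h1 /hl h2] w p.
have e1 := mulxcD (- 1 - p) (- z) (- 1 - (m%:R + qfrac T j2))
  (Ystar_bounded aut1 aut2 Ks hv al0 w) (Ystar_bounded aut1 aut2 Ks hv be0 w).
have e2 := mulcxD (m%:R + qfrac T j2) 1 p
  (bounded_below_app w Gb) (bounded_below_app w Hb).
apply: etrans (congr2 (fun a b => a - b) e1 e2) _.
have swap (a b c d : K) : (a + b) - (c + d) = (a - c) + (b - d) by ring.
apply: etrans (swap _ _ _ _) _.
by apply: etrans (congr2 +%R (h1 w p) (h2 w p)) _; rewrite addr0.
Qed.

Lemma Ystar_vac al p w : al 0 = 0 ->
  Ystar (vac V) al p w = if p == 0 then al w else 0.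
Proof. by move=> al0; rewrite /Ystar Yopp_vac; case: ifP. Qed.

Lemma eigen2_vac : eigen2 T s1 s2 0 0 (vac V).
Proof. by split; exact: eigen_vac. Qed.

Lemma delta_coset al p : p + qfrac T 0 \isn't a Num.int ->
  (if p == 0 then al else 0) = 0.
Proof.
by rewrite /qfrac mul0r addr0; case: eqP => // ->; rewrite rpred0.
Qed.

Lemma delta_bounded al : bounded_below (fun p : rat => if p == 0 then al else 0).
Proof. by exists 0 => p p0; rewrite lt_eqF. Qed.

Lemma matchR_vac al : al 0 = 0 ->
  matchR z 0 0 (vac V) al (fun p => if p == 0 then al else 0).
Proof.
move=> al0; split; [by move=> p /delta_coset->|exact: delta_bounded|].
exists 0%N => k _ w p; rewrite /qfrac mul0r addr0 -[k%:R]add0r.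
apply: (rec_zero (defectR_rec aut1 aut2 Ks z_neq0 eigen2_vac al0
  (bounded_below_app w (delta_bounded al)))) => r.
by rewrite /defectR mulxc0 mulcx0 epi0 mul1r Ystar_vac//; case: ifP; rewrite subrr.
Qed.

Lemma matchL_vac al : al 0 = 0 ->
  matchL z 0 0 (vac V) al (fun p => if p == 0 then al else 0).
Proof.
move=> al0; split; [by move=> p /delta_coset->|exact: delta_bounded|].
exists 0%N => k _ w p; rewrite /qfrac mul0r addr0 -[k%:R]add0r.
apply: (rec_zero (defectL_rec aut1 aut2 Ks z_neq0 eigen2_vac al0
  (bounded_below_app w (delta_bounded al)))) => r.
rewrite /defectL mulcx0 subr0; apply/eqP; rewrite subr_eq0; apply/eqP.
rewrite /mulxc; have E : - 1 - (- 1 - r) = r by ring.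
(* For r = -n only i = n survives; up to sign and a power of z its coefficient is binom(n - 1, n),
   which is 0 unless n = 0. *)
case: (pselect (exists n : nat, r = - n%:R)) => [[n rn]|rn].
  rewrite (@fsum_only _ _ n) => [|i ni].
    rewrite E exprNn [_ * ((-1) ^+ n * _)]mulrA [gbinom _ _ _ * _]mulrC gbinom_neg.
    rewrite Ystar_vac// rn addNr eqxx (_ : _ - _ = 0); last by ring.
    rewrite gbinom_0n oppr_eq0 pnatr_eq0; case: eqP => [->|_].
      by rewrite expr0 !mul1r.
    by rewrite !mul0r.
  rewrite E Ystar_vac// rn; case: eqP; last by rewrite mulr0.
  by rewrite addrC => /subr0_eq/eqP; rewrite eqr_nat => /eqP/ni.
rewrite fsbig1 => [|i _].
  by case: eqP => // r0; case: rn; exists 0%N; rewrite r0 oppr0.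
rewrite E Ystar_vac//; case: eqP => [/eqP|]; last by rewrite mulr0.
by rewrite addr_eq0 => /eqP ri; case: rn; exists i.
Qed.

End MatchProperties.

(** * Intertwining maps and homomorphisms *)

Section Main.
Variables (R : realType) (V : voa R) (T : nat) (s1 s2 s : V -> V) (z : R[i]).
Hypotheses (T_gt0 : (0 < T)%N) (aut1 : voa_aut s1) (aut2 : voa_aut s2).
Hypotheses (s1T : forall v, iter T s1 v = v) (s2T : forall v, iter T s2 v = v).
Hypotheses (Ks : cancel (s1 \o s2) s) (z_neq0 : z != 0).
Variables (W : twisted_module T s) (W1 : twisted_module T s1) (W2 : twisted_module T s2).
Variable F : {linear tensor W1 W2 -> dual W}.
Local Notation K := (R[i]).
Implicit Types (v : V) (x y : tensor W1 W2) (p q r : rat).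

Definition Ff x : W -> K^o := F x.

Lemma Ff_linear : linear Ff.
Proof. by move=> a x y; rewrite /Ff linearP; exact: dual_fun_linear. Qed.

Lemma Ff_app0 x : Ff x 0 = 0.
Proof. exact: linear_fun0 (@dual_linear _ _ (F x)). Qed.

(** The actions are taken on lists of pairs, so that the outcome of one is again a list on which the
    other acts. *)
Definition right_action v p (e : seq (W1 * W2)) :=
  [seq (a.1, Ytm v p a.2) | a <- e].

Definition left_action v p (e : seq (W1 * W2)) :=
  [seq (Ytm v p a.1, a.2) | a <- e].

Lemma pure_right_coset j1 j2 v (w1 : W1) (w2 : W2) : eigen2 T s1 s2 j1 j2 v ->
  forall p, p + qfrac T j2 \isn't a Num.int -> Ff (tpure w1 (Ytm v p w2)) = 0.
Proof.
move=> [_ v2] p pi; have [-> //] := Ytm_eigen w2 v2.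
by rewrite tpure0r (linear_fun0 Ff_linear).
Qed.

Lemma pure_left_coset j1 j2 v (w1 : W1) (w2 : W2) : eigen2 T s1 s2 j1 j2 v ->
  forall p, p + qfrac T j1 \isn't a Num.int -> Ff (tpure (Ytm v p w1) w2) = 0.
Proof.
move=> [v1 _] p pi; have [-> //] := Ytm_eigen w1 v1.
by rewrite tpure0l (linear_fun0 Ff_linear).
Qed.

Lemma pure_right_bounded j1 j2 v (w1 : W1) (w2 : W2) : eigen2 T s1 s2 j1 j2 v ->
  bounded_below (fun p => Ff (tpure w1 (Ytm v p w2))).
Proof.
move=> [_ v2]; have [_ [N hN]] := Ytm_eigen w2 v2; exists N => p /hN->.
by rewrite tpure0r (linear_fun0 Ff_linear).
Qed.

Lemma pure_left_bounded j1 j2 v (w1 : W1) (w2 : W2) : eigen2 T s1 s2 j1 j2 v ->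
  bounded_below (fun p => Ff (tpure (Ytm v p w1) w2)).
Proof.
move=> [v1 _]; have [_ [N hN]] := Ytm_eigen w1 v1; exists N => p /hN->.
by rewrite tpure0l (linear_fun0 Ff_linear).
Qed.

Lemma P_intertwiningE : P_intertwining z F <->
  forall j1 j2 v, eigen2 T s1 s2 j1 j2 v -> forall (w1 : W1) (w2 : W2) (w : W) a p,
    a - qfrac T j1 \is a Num.int -> p + qfrac T j2 \is a Num.int ->
    mulxc a (- z) ((Ystar v (Ff (tpure w1 w2)))^~ w) p
    - epi R a * mulcx z a (-1) (fun q => Ff (tpure w1 (Ytm v q w2)) w) p =
    deltamul z (fun q => Ff (tpure (Ytm v q w1) w2) w) (- 1 - a) p.
Proof.
have E j1 j2 v (w1 : W1) (w2 : W2) (w : W) : eigen2 T s1 s2 j1 j2 v -> _ := fun hv =>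
  @intertwining_coset R z (qfrac T j1) (qfrac T j2)
    ((Ystar v (Ff (tpure w1 w2)))^~ w)
    (fun q => Ff (tpure w1 (Ytm v q w2)) w)
    (fun q => Ff (tpure (Ytm v q w1) w2) w)
    (Ystar_coset aut1 aut2 Ks hv (Ff_app0 _) w)
    (fun p pi => congr1 (@^~ w) (pure_right_coset w1 w2 hv pi))
    (fun p pi => congr1 (@^~ w) (pure_left_coset w1 w2 hv pi)).
split=> J j1 j2 v hv w1 w2 w.
  by apply/(E _ _ _ w1 w2 w hv) => r p; exact: J.
by have /(E _ _ _ w1 w2 w hv) := J _ _ _ hv w1 w2 w.
Qed.

(** * From the P(z)-identity to the homomorphism property *)

Section FromIntertwining.
Hypothesis J : P_intertwining z F.

Lemma matchR_pure j1 j2 v (w1 : W1) (w2 : W2) : eigen2 T s1 s2 j1 j2 v ->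
  matchR z j1 j2 v (Ff (tpure w1 w2)) (fun p => Ff (tpure w1 (Ytm v p w2))).
Proof.
move=> hv; have cR := pure_right_coset w1 w2 hv.
split=> //; first exact: pure_right_bounded hv.
have [N hN] := pure_left_bounded w1 w2 hv.
(* Past k0 the exponent -1-k-q1 of x_0 lies below the truncation of Y(v,x_0) w1, and the right side
   of the P(z)-identity vanishes. *)
have [k0 hk] := nat_bound (- 1 - qfrac T j1 - N); exists k0 => k /hk kN w p.
have [pi|pi] := boolP (p + qfrac T j2 \is a Num.int).
  rewrite /defectR; have /P_intertwiningE/(_ _ _ _ hv w1 w2 w) -> // := J.
    rewrite /deltamul fsbig1// => i _; rewrite hN ?mulr0//.
    rewrite -subr_gt0; set q1 := qfrac T j1 in kN *.
    have -> : N - (- 1 - (k%:R + q1) - i%:R) = (k%:R - (- 1 - q1 - N)) + i%:R by ring.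
    by apply: ltr_wpDr => //; rewrite subr_gt0.
  by rewrite addrK natr_int.
rewrite /defectR (mulcx_coset _ _ _ _ pi); last by move=> q /cR ->.
rewrite (mulxc_coset _ (Ystar_coset aut1 aut2 Ks hv (Ff_app0 _) w)) ?mulr0 ?subrr//.
apply: contra pi; set q1 := qfrac T j1; set q2 := qfrac T j2 => pi.
have -> : p + q2 = p - (k%:R + q1) + (q1 + q2) + k%:R by ring.
by rewrite rpredD// natr_int.
Qed.

Lemma matchL_pure j1 j2 v (w1 : W1) (w2 : W2) : eigen2 T s1 s2 j1 j2 v ->
  matchL z j1 j2 v (Ff (tpure w1 w2)) (fun p => Ff (tpure (Ytm v p w1) w2)).
Proof.
move=> hv; have cL := pure_left_coset w1 w2 hv.
split=> //; first exact: pure_left_bounded hv.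
have [N hN] := pure_right_bounded w1 w2 hv.
(* Past l0 the position -1-l-q2 lies below the truncation of Y(v,x) w2, so the term in g drops out
   there for every a. *)
have [l0 hl] := nat_bound (- 1 - qfrac T j2 - N); exists l0 => l /hl lN w r.
have [ri|ri] := boolP (r + qfrac T j1 \is a Num.int).
  have /P_intertwiningE/(_ _ _ _ hv w1 w2 w (- 1 - r) (- 1 - (l%:R + qfrac T j2))) := J.
  have pN : - 1 - (l%:R + qfrac T j2) < N.
    rewrite -subr_gt0; set q2 := qfrac T j2 in lN *.
    have -> : N - (- 1 - (l%:R + q2)) = l%:R - (- 1 - q2 - N) by ring.
    by rewrite subr_gt0.
  rewrite (mulcx_bounded _ _ _ _ pN); last by move=> p /hN->.
  rewrite mulr0 subr0 /defectL => ->; first last.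
  - set q2 := qfrac T j2; have -> : - 1 - (l%:R + q2) + q2 = - 1 - l%:R by ring.
    by rewrite rpredB ?natr_int// rpredN rpred1.
  - set q1 := qfrac T j1 in ri *; have -> : - 1 - r - q1 = - 1 - (r + q1) by ring.
    by rewrite rpredB// rpredN rpred1.
  by rewrite deltamul_mulcx [- 1 - (- 1 - r)](_ : _ = r) ?subrr//; ring.
rewrite /defectL (mulcx_coset _ _ _ _ ri); last by move=> q /cL ->.
rewrite (mulxc_coset _ (Ystar_coset aut1 aut2 Ks hv (Ff_app0 _) w)) ?subrr//.
apply: contra ri; set q1 := qfrac T j1; set q2 := qfrac T j2 => ri.
have -> : r + q1 = - 1 - (l%:R + q2) - (- 1 - r) + (q1 + q2) + l%:R by ring.
by rewrite rpredD// natr_int.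
Qed.

Lemma matchR_tclass j1 j2 v (e : seq (W1 * W2)) : eigen2 T s1 s2 j1 j2 v ->
  matchR z j1 j2 v (Ff (tclass e)) (fun p => Ff (tclass (right_action v p e))).
Proof.
move=> hv; elim: e => [|[w1 w2] e ih].
  rewrite [X in matchR _ _ _ _ X](_ : _ = 0); last exact: linear_fun0 Ff_linear.
  rewrite [X in matchR _ _ _ _ _ X](_ : _ = 0); first exact: matchR0.
  by apply/funext => p; exact: linear_fun0 Ff_linear.
have cons_tclass a b : Ff (tclass ((a, b) :: e)) = Ff (tpure a b) + Ff (tclass e).
  by rewrite tclass_sum big_cons -tclass_sum (linear_funD Ff_linear).
rewrite cons_tclass [X in matchR _ _ _ _ _ X](_ : _ = fun p =>
    Ff (tpure w1 (Ytm v p w2)) + Ff (tclass (right_action v p e))).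
  by apply: (matchRD aut1 aut2 Ks hv) => //; [exact: Ff_app0|exact: Ff_app0|exact: matchR_pure].
by apply/funext => p; rewrite /= tclass_sum big_cons -tclass_sum (linear_funD Ff_linear).
Qed.

Lemma matchL_tclass j1 j2 v (e : seq (W1 * W2)) : eigen2 T s1 s2 j1 j2 v ->
  matchL z j1 j2 v (Ff (tclass e)) (fun p => Ff (tclass (left_action v p e))).
Proof.
move=> hv; elim: e => [|[w1 w2] e ih].
  rewrite [X in matchL _ _ _ _ X](_ : _ = 0); last exact: linear_fun0 Ff_linear.
  rewrite [X in matchL _ _ _ _ _ X](_ : _ = 0); first exact: matchL0.
  by apply/funext => p; exact: linear_fun0 Ff_linear.
have cons_tclass a b : Ff (tclass ((a, b) :: e)) = Ff (tpure a b) + Ff (tclass e).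
  by rewrite tclass_sum big_cons -tclass_sum (linear_funD Ff_linear).
rewrite cons_tclass [X in matchL _ _ _ _ _ X](_ : _ = fun p =>
    Ff (tpure (Ytm v p w1) w2) + Ff (tclass (left_action v p e))).
  by apply: (matchLD aut1 aut2 Ks hv) => //; [exact: Ff_app0|exact: Ff_app0|exact: matchL_pure].
by apply/funext => p; rewrite /= tclass_sum big_cons -tclass_sum (linear_funD Ff_linear).
Qed.

Lemma YLR_tensor i1 i2 u j1 j2 v p x : eigen2 T s1 s2 i1 i2 u ->
  eigen2 T s1 s2 j1 j2 v ->
  YLR z i1 i2 u j1 j2 v p (Ff x) = Ff (Ytensor (tpure u v) p x).
Proof.
move=> hu hv; pose e := repr x.
have -> : Ff x = Ff (tclass e) by rewrite tclass_sum -tensor_sum.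
pose X q := Ff (\sum_(a <- e) tpure (Ytm u q a.1) (Ytm v (p - q) a.2)).
(* [YLR] gives the index q to v and [Ypair] gives it to u, whence the reflection q -> p - q. *)
transitivity (\sum_(q \in [set: rat]) X (p - q)).
  apply: eq_fsbigr => q _.
  rewrite (YR_match aut1 aut2 Ks z_neq0 hv (Ff_app0 _) _ (matchR_tclass e hv)).
  rewrite (YL_match aut1 aut2 Ks z_neq0 hu (Ff_app0 _) _ (matchL_tclass _ hu)).
  rewrite /X tclass_sum /left_action /right_action -map_comp big_map /=.
  by rewrite [p - (p - q)](_ : _ = q)//; ring.
have subI : injective (fun q => p - q) by move=> q q' /addrI/oppr_inj.
rewrite -(@fsum_reindex _ _ _ (fun q => p - q) X subI) => [|q qN]; last first.
  by case: (qN (p - q)); ring.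
rewrite (Ytensor_pure T_gt0 aut1 aut2 s1T s2T).
rewrite -/e; have := fsum_exchange e (fun a : W1 * W2 =>
  Ytm_pair_finite T_gt0 aut1 aut2 s1T s2T u v p a.1 a.2).
by move=> [fin ->]; rewrite (linear_fun_fsum Ff_linear fin).
Qed.

Lemma hom_of_P_intertwining : hom_into_Dreg z F.
Proof.
split=> [x|a p x be].
  split=> [|j1 j2 v hv]; first exact: dual_linear.
  by have := matchR_good (matchR_tclass (repr x) hv); rewrite tclass_sum -tensor_sum.
elim=> [|i1 i2 u j1 j2 v {}a {}be hu hv _ ->].
  by rewrite (Ytensor0 T_gt0 aut1 aut2 s1T s2T) -[RHS]/(Ff 0) (linear_fun0 Ff_linear).
rewrite (YtensorD T_gt0 aut1 aut2 s1T s2T) -[RHS]/(Ff _) (linear_funD Ff_linear); congr (_ + _).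
exact: YLR_tensor.
Qed.

End FromIntertwining.

(** * From the homomorphism property to the P(z)-identity *)

Section FromHomomorphism.
Hypothesis hom : hom_into_Dreg z F.

Lemma hom_goodR j1 j2 v x : eigen2 T s1 s2 j1 j2 v ->
  exists k, goodR z j1 j2 v (Ff x) k.
Proof. by have [/(_ x)[_ h] _] := hom; exact: h. Qed.

Lemma hom_YLR i1 i2 u j1 j2 v p (w1 : W1) (w2 : W2) :
  eigen2 T s1 s2 i1 i2 u -> eigen2 T s1 s2 j1 j2 v ->
  YLR z i1 i2 u j1 j2 v p (Ff (tpure w1 w2)) = Ff (Ypair u v p w1 w2).
Proof.
move=> hu hv; have [_ h] := hom.
have := h _ p (tpure w1 w2) _ (Yreg_add hu hv (Yreg_zero s1 s2 z p (Ff (tpure w1 w2)))).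
by rewrite !addr0 (Ytensor_pure_pure T_gt0 aut1 aut2 s1T s2T).
Qed.

(** With the vacuum as first factor, Y^L acts as the identity and the composite reduces to Y^R. *)
Lemma hom_YR j1 j2 v p (w1 : W1) (w2 : W2) : eigen2 T s1 s2 j1 j2 v ->
  YR z j1 j2 v p (Ff (tpure w1 w2)) = Ff (tpure w1 (Ytm v p w2)).
Proof.
move=> hv; have hvac := eigen2_vac T aut1 aut2.
have := hom_YLR p w1 w2 hvac hv.
rewrite /Ypair (@fsum_only _ _ 0) => [|q q0]; last first.
  by rewrite Ytm_vac; case: eqP => // _; rewrite tpure0l.
rewrite Ytm_vac eqxx subr0 => <-; rewrite /YLR.
(* [YL_match] asks its functional to vanish at 0. Here this is a value of Y^R, not yet known to be
   one of F, so the formula for [YR] is evaluated. *)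
have YR0 q : YR z j1 j2 v q (Ff (tpure w1 w2)) 0 = 0.
  have -> : YR z j1 j2 v q (Ff (tpure w1 w2)) 0 = epi R (- ((xget 0%N
      (goodR z j1 j2 v (Ff (tpure w1 w2))))%:R + qfrac T j1)) * 0; last by rewrite mulr0.
  congr (_ * _); apply: fsbig1 => r _; rewrite [X in _ * X]fsbig1 ?mulr0// => r' _.
  by rewrite /Ystar Yopp0 Ff_app0 mulr0.
have YLv q r : YL z 0 0 (vac V) q (YR z j1 j2 v r (Ff (tpure w1 w2))) =
    if q == 0 then YR z j1 j2 v r (Ff (tpure w1 w2)) else 0.
  exact: (YL_match aut1 aut2 Ks z_neq0 hvac (YR0 r) _ (matchL_vac aut1 aut2 Ks z_neq0 (YR0 r))).
rewrite (@fsum_only _ _ p) => [|q qp]; rewrite YLv; first by rewrite subrr eqxx.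
by rewrite subr_eq0 eq_sym; case: eqP.
Qed.

Lemma hom_YL j1 j2 v p (w1 : W1) (w2 : W2) : eigen2 T s1 s2 j1 j2 v ->
  YL z j1 j2 v p (Ff (tpure w1 w2)) = Ff (tpure (Ytm v p w1) w2).
Proof.
move=> hv; have hvac := eigen2_vac T aut1 aut2.
have := hom_YLR p w1 w2 hv hvac.
rewrite /Ypair (@fsum_only _ _ p) => [|q qp]; last first.
  rewrite Ytm_vac subr_eq0 eq_sym; case: eqP => // _; exact: tpure0r.
rewrite Ytm_vac subrr eqxx => <-; rewrite /YLR.
have YRv q : YR z 0 0 (vac V) q (Ff (tpure w1 w2)) =
    if q == 0 then Ff (tpure w1 w2) else 0.
  exact: (YR_match aut1 aut2 Ks z_neq0 hvac (Ff_app0 _) _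
    (matchR_vac aut1 aut2 Ks z_neq0 (Ff_app0 _))).
rewrite (@fsum_only _ _ 0) => [|q q0]; rewrite YRv; first by rewrite eqxx subr0.
case: eqP => // _.
exact: (YL_match aut1 aut2 Ks z_neq0 hv _ _ (matchL0 z W j1 j2 v)).
Qed.

Lemma P_intertwining_of_hom : P_intertwining z F.
Proof.
apply/P_intertwiningE => j1 j2 v hv w1 w2 w a p ai pi.
have good := hom_goodR (tpure w1 w2) hv.
have := YR_matches aut1 aut2 Ks z_neq0 hv (Ff_app0 _) good.
rewrite [X in matchR _ _ _ _ _ X](_ : _ = fun p => Ff (tpure w1 (Ytm v p w2))); last first.
  by apply/funext => q; exact: hom_YR.
move=> [_ Gb [k0 hk]]; have {}Gb := bounded_below_app w Gb.
have := YL_matches aut1 aut2 Ks z_neq0 hv (Ff_app0 _)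
  (goodR_goodL aut1 aut2 Ks hv (Ff_app0 _) good).
rewrite [X in matchL _ _ _ _ _ X](_ : _ = fun p => Ff (tpure (Ytm v p w1) w2)); last first.
  by apply/funext => q; exact: hom_YL.
move=> [_ Hb [l0 hl]]; have {}Hb := bounded_below_app w Hb.
set f := (Ystar v (Ff (tpure w1 w2)))^~ w.
have fb : bounded_above f := Ystar_bounded aut1 aut2 Ks hv (Ff_app0 _) w.
set g := (fun q => _) in Gb *; set h := (fun q => _) in Hb *.
pose D b r := mulxc b (- z) f r - epi R b * mulcx z b (-1) g r - deltamul z h (- 1 - b) r.
have D_rec b r : D (b + 1) r = D b (r - 1) + - z * D b r.
  rewrite /D mulxc_rec// mulcx_rec// epiD epi1.
  have -> : - 1 - (b + 1) = - 1 - b - 1 by ring.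
  by rewrite deltamul_rec//; ring.
set q1 := qfrac T j1 in hk ai; set q2 := qfrac T j2 in hl pi.
have [N hN] := Hb; have [k1 hk1] := nat_bound (- 1 - q1 - N).
have [M hM] := Gb; have [l1 hl1] := nat_bound (- 1 - q2 - M).
(* k0 and l0 serve the relations for Y^R and Y^L; k1 makes the term in h vanish, and l1 makes the
   term in g vanish at position -1-l-q2. *)
pose k := maxn k0 k1; pose l := maxn l0 l1.
have Dtop d r : D (k%:R + q1 + d%:R) r = 0.
  have -> : k%:R + q1 + d%:R = (k + d)%:R + q1 by rewrite natrD; ring.
  rewrite /D [X in _ - X](_ : _ = 0).
    by rewrite subr0; apply: hk; rewrite (leq_trans (leq_maxl _ _) (leq_addr _ _)).
  rewrite /deltamul fsbig1// => i _; rewrite hN ?mulr0//.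
  have := hk1 (k + d)%N (leq_trans (leq_maxr _ _) (leq_addr _ _)).
  rewrite -subr_gt0 => kd; rewrite -subr_gt0.
  have -> : N - (- 1 - ((k + d)%:R + q1) - i%:R) =
    ((k + d)%:R - (- 1 - q1 - N)) + i%:R by ring.
  exact: ltr_wpDr.
(* At this position [deltamul] is a binomial power acting on h, and D becomes the Y^L-defect of
   exponent l + q2 at r = -1 - b. *)
have Dline (n : int) : D (k%:R + q1 + n%:~R) (- 1 - (l%:R + q2)) = 0.
  set b := _ + _ + _; rewrite /D (mulcx_bounded _ _ _ hM); last first.
    have := hl1 l (leq_maxr _ _); rewrite -subr_gt0 => ll; rewrite -subr_gt0.
    by have -> : M - (- 1 - (l%:R + q2)) = l%:R - (- 1 - q2 - M) by ring.
  rewrite mulr0 subr0 deltamul_mulcx.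
  have := hl l (leq_maxl _ _) w (- 1 - b); rewrite /defectL.
  by have -> : - 1 - (- 1 - b) = b by ring.
apply/eqP; rewrite -subr_eq0; apply/eqP; rewrite -[LHS]/(D a p).
move: ai pi => /intrP[n an] /intrP[m pm].
(* The coset conditions place (a, p) at an integral offset from the base point (k + q1, -1-l-q2) of
   [rec_descent]. *)
have -> : a = k%:R + q1 + (n - k%:Z)%:~R.
  by rewrite rmorphB /= -an -[k%:Z%:~R]/(k%:R); ring.
have -> : p = - 1 - (l%:R + q2) + (m + 1 + l%:Z)%:~R.
  by rewrite !rmorphD /= -pm -[l%:Z%:~R]/(l%:R); ring.
by apply: (rec_descent _ D_rec) => //; rewrite oppr_eq0.
Qed.

End FromHomomorphism.
End Main.

Theorem theorem4p7 (R : realType) (V : voa R) (T : nat) (hT : (0 < T)%N)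
  (s1 s2 s : V -> V) (aut1 : voa_aut s1) (aut2 : voa_aut s2)
  (s12 : forall v : V, s1 (s2 v) = s2 (s1 v))
  (s1T : forall v : V, iter T s1 v = v) (s2T : forall v : V, iter T s2 v = v)
  (sK : cancel s (s1 \o s2)) (Ks : cancel (s1 \o s2) s)
  (z : R[i]) (hz : z != 0)
  (W : twisted_module T s) (W1 : twisted_module T s1) (W2 : twisted_module T s2)
  (F : {linear tensor W1 W2 -> dual W}) :
  P_intertwining z F <-> hom_into_Dreg z F.
Proof.
split; first exact: hom_of_P_intertwining.
exact: P_intertwining_of_hom.
Qed.
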